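(* Consider a sequence of random Poisson graphical models $\{G_n\}$ over a finite alphabet $\mathcal X$. Let $\nu_n(\cdot,\cdot)$ be the type of two i.i.d. replicas $\underline X^{(1)},\underline X^{(2)}$ (conditionally i.i.d. given $G_n$, each with law the canonical measure $\mu_{G_n}$), let $\overline\nu(x,y)=1/|\mathcal X|^2$ and $\Delta\nu_n(x,y)=\nu_n(x,y)-\overline\nu(x,y)$. Assume that, for any $x\in\mathcal X$, $$\lim_{n\to\infty}\mathbb E\Big\{\Big[\Delta\nu_n(x,x)-2|\mathcal X|^{-1}\sum_{x'}\Delta\nu_n(x,x')\Big]^2\Big\}=0,$$ where the expectation is over both $G_n$ and the two replicas. Then the reconstruction problem for $\{G_n\}$ is solvable if and only if it is tree-solvable.
   Context: Poisson graphical models: fix a finite alphabet $\mathcal X$, a density $\gamma\ge0$, a finite collection of non-negative symmetric functions $\psi_a:\mathcal X\times\mathcal X\to[0,\infty)$, $a\in\mathcal C$, and a probability distribution $\{p(a):a\in\mathcal C\}$. $G_n$ is a random multi-graph on vertex set $[n]$: edge multiplicities between pairs $i\ne j$ are independent Poisson$(2\gamma/n)$, and each vertex has an independent Poisson$(\gamma/n)$ number of self-loops. Each edge occurrence $e=\{e_1,e_2\}$ (including self-loops) carries an independent $A_e\in\mathcal C$ of law $p$. The canonical measure is $\mu_{G_n}(\underline x)=\frac1{Z}\prod_{e\in G_n}\psi_{A_e}(x_{e_1},x_{e_2})$ on $\mathcal X^n$ (assumed well defined, i.e. $Z>0$). The root $\o$ is uniform in $[n]$, independent of the graph and specification. Two-replica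 type: $\nu_n(x,y)$ is the fraction of vertices $j\in[n]$ with $X^{(1)}_j=x$ and $X^{(2)}_j=y$. For a rooted graph and $t\ge0$, $\overline{\mathsf B}_{\o}(t)$ is the set of vertices at graph distance at least $t$ from the root $\o$. $\mu_U$ is the marginal of $\mu$ on the variables in $U$, $\mu_{\o,U}$ the joint law of $(x_{\o},\underline x_U)$, and $\|\cdot\|_{TV}$ total variation distance. The reconstruction problem is $(t,\varepsilon)$-solvable for a rooted graphical model with measure $\mu$ if $\|\mu_{\o,\overline{\mathsf B}_{\o}(t)}-\mu_{\o}\times\mu_{\overline{\mathsf B}_{\o}(t)}\|_{TV}\ge\varepsilon$. It is solvable for the sequence of random rooted graphical models $\{G_n\}$ if, for some $\varepsilon>0$, $\inf_t\limsup_{n\to\infty}\mathbb P\{A_n(t)\}>0$, where $A_n(t)$ is the event that the problem is $(t,\varepsilon)$-solvable on $G_n$. Let $\mathsf T$ be the Galton-Watson tree with Poisson$(2\gamma)$ offspring distribution rooted at $\o$ (the local limit of $G_n$), and $\mathsf T(\ell)$ the graphical model on its first $\ell$ generations, each edge carrying $\psi_a$ with probability $p(a)$ independently of all else; its canonical measure is $\mu^{\mathsf T(\ell)}$ (product of the edge weights, normalized). The reconstruction problem is tree-solvable for $\{G_n\}$ if it is solvable for the sequence $\{\mathsf T(\ell)\}_{\ell}$, i.e. for some $\varepsilon>0$, $\inf_t\limsup_{\ell\to\infty}\mathbb P\{\|\mu^{\mathsf T(\ell)}_{\o,\overline{\mathsf B}_{\o}(t)}-\mu^{\mathsf T(\ell)}_{\o}\times\mu^{\mathsf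 T(\ell)}_{\overline{\mathsf B}_{\o}(t)}\|_{TV}\ge\varepsilon\}>0$. *)

(* Defs.v *)
From mathcomp Require Import all_boot all_order all_algebra.
From mathcomp Require Import all_classical all_reals all_analysis.
Set Implicit Arguments.
Unset Strict Implicit.
Unset Printing Implicit Defensive.
Import Order.TTheory GRing.Theory Num.Theory.
Import numFieldNormedType.Exports.
Local Open Scope ring_scope.

(* Finite multigraphs with edges marked in [C].  An edge occurrence is a triple
   ((u, v), a); it is unoriented (all uses below are symmetric in u and v), may
   be a self-loop (u = v), and may occur several times in the sequence. *)
Record mgraph (C : Type) := MGraph {
  vert : finType;
  edges : seq (vert * vert * C) }.

Record rgraph (C : Type) := RGraph {
  base :> mgraph C;
  groot : vert base }.

Section Distance.
Variable C : Type.

Definition adj (G : mgraph C) : rel (vert G) := fun u v =>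
  has (fun e => (e.1 == (u, v)) || (e.1 == (v, u))) (edges G).

(* Vertices at distance at least t from the root, i.e. not reached from the
   root by a walk of length k < t.  Vertices in other connected components are
   at infinite distance and hence belong to the set. *)
Definition far (G : rgraph C) (t : nat) : {set vert G} :=
  finset (fun v => ~~ [exists k : 'I_t, [exists w : k.-tuple (vert G),
    path (@adj G) (groot G) w && (last (groot G) w == v)]]).

End Distance.

Section FiniteLaws.
Variable R : realType.

Definition law_of (S T : finType) (q : S -> R) (f : S -> T) : T -> R :=
  fun z => \sum_(x | f x == z) q x.

Definition tv_dist (T : finType) (q r : T -> R) : R :=
  2^-1 * \sum_z `|q z - r z|.

End FiniteLaws.

Section GraphicalModel.
Variables (R : realType) (X C : finType) (psi : C -> X -> X -> R).

Definition weight (G : mgraph C) (x : {ffun vert G -> X}) : R :=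
  \prod_(e <- edges G) psi e.2 (x e.1.1) (x e.1.2).

Definition partition_fun (G : mgraph C) : R :=
  \sum_(x : {ffun vert G -> X}) weight x.

Definition canonical_measure (G : mgraph C) (x : {ffun vert G -> X}) : R :=
  weight x / partition_fun G.

Definition restr_to (V : finType) (U : {set V}) (x : {ffun V -> X}) :
  {ffun {v : V | v \in U} -> X} := [ffun v => x (val v)].

Definition recon_tv (G : rgraph C) (t : nat) : R :=
  let mu := @canonical_measure G in
  let x_root (x : {ffun vert G -> X}) := x (groot G) in
  let x_far := restr_to (far G t) in
  tv_dist (law_of mu (fun x => (x_root x, x_far x)))
          (fun z => law_of mu x_root z.1 * law_of mu x_far z.2).

Definition solvable_at (t : nat) (eps : R) (G : rgraph C) : Prop :=
  eps <= recon_tv G t.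

(* A random rooted graph with a discrete law: a countable sample space with its
   probability mass function, and the graph as a function of the outcome. *)
Record random_rgraph := RandomRGraph {
  outcome : countType;
  mass : outcome -> R;
  graph_at : outcome -> rgraph C }.

Definition Pr (G : random_rgraph) (A : rgraph C -> Prop) : \bar R :=
  (\esum_(w in [set w : outcome G | A (graph_at w)]%classic) (mass w)%:E)%E.

Definition recon_solvable (G : nat -> random_rgraph) : Prop :=
  exists2 eps : R, 0 < eps &
    (0 < ereal_inf (range (fun t : nat =>
           limn_esup (fun n => Pr (G n) (solvable_at t eps)))))%E.

End GraphicalModel.

(* The library's [poisson_pmf] is the constant 1 at rate 0; this is the usual
   mass function, which at rate 0 is the point mass at 0. *)
Definition poisson_mass (R : realType) (rate : R) (k : nat) : R :=
  expR (- rate) * rate ^+ k / k`!%:R.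

Section PoissonModel.
Variables (R : realType) (C : finType) (gamma : R) (p : C -> R).

Definition vpair (n : nat) : finType :=
  {ij : 'I_n * 'I_n | (ij.1 <= ij.2)%N}.

(* To each unordered pair {i, j}, possibly with i = j, the list of the marks of
   the edges joining i and j, the length of which is the edge multiplicity. *)
Definition edge_marks (n : nat) : countType := {ffun vpair n -> seq C}.

Definition mgraph_of (n : nat) (g : edge_marks n) : mgraph C :=
  @MGraph C 'I_n (flatten [seq [seq (val ij, a) | a <- g ij] | ij : vpair n]).

Definition edge_rate (n : nat) (ij : vpair n) : R :=
  if (val ij).1 == (val ij).2 then gamma / n%:R else 2 * gamma / n%:R.

Definition poisson_graph_pmf (n : nat) (g : edge_marks n) : R :=
  \prod_(ij : vpair n)
    (poisson_mass (edge_rate ij) (size (g ij)) * \prod_(a <- g ij) p a).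

Definition poisson_model (n : nat) : random_rgraph R C :=
  @RandomRGraph R C (edge_marks n * 'I_n)%type
    (fun w => poisson_graph_pmf w.1 / n%:R)
    (fun w => @RGraph C (mgraph_of w.1) w.2).

(* Realizations of the marked Galton-Watson tree truncated at generation l: the
   list of the subtrees at the children of the root, each with the mark of the
   edge leading to it. *)
Fixpoint gwtree (l : nat) : countType :=
  if l is l'.+1 then seq (C * gwtree l')%type : countType
  else unit : countType.

Definition join_root (k : nat) (mark : 'I_k -> C) (G : 'I_k -> rgraph C) :
  rgraph C :=
  let V (i : 'I_k) := vert (G i) in
  let emb i (v : V i) : option {i : 'I_k & V i} := Some (Tagged V v) in
  @RGraph C
    (@MGraph C (option {i : 'I_k & V i})
       (flatten [seq (None, emb i (groot (G i)), mark i) ::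
                     [seq (emb i e.1.1, emb i e.1.2, e.2) | e <- edges (G i)]
                | i : 'I_k]))
    None.

Fixpoint gwgraph (l : nat) : gwtree l -> rgraph C :=
  if l is l'.+1 then
    fun s : gwtree l'.+1 =>
      join_root (fun i => (tnth (in_tuple s) i).1)
                (fun i => gwgraph (tnth (in_tuple s) i).2)
  else fun _ => @RGraph C (@MGraph C unit [::]) tt.

(* Poisson(2 gamma) children of the root, with i.i.d. edge marks and subtrees. *)
Fixpoint gw_pmf (l : nat) : gwtree l -> R :=
  if l is l'.+1 then
    fun s : gwtree l'.+1 =>
      poisson_mass (2 * gamma) (size s) * \prod_(c <- s) (p c.1 * gw_pmf c.2)
  else fun _ => 1.

Definition gw_model (l : nat) : random_rgraph R C :=
  @RandomRGraph R C (gwtree l) (@gw_pmf l) (@gwgraph l).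

Variables (X : finType) (psi : C -> X -> X -> R).

Definition tree_solvable : Prop := recon_solvable psi gw_model.

Definition two_type (n : nat) (x1 x2 : {ffun 'I_n -> X}) (x y : X) : R :=
  #|[pred j | (x1 j == x) && (x2 j == y)]|%:R / n%:R.

Definition delta_type (n : nat) (x1 x2 : {ffun 'I_n -> X}) (x y : X) : R :=
  two_type x1 x2 x y - 1 / #|X|%:R ^+ 2.

(* Expectation, over the graph and two conditionally i.i.d. replicas, of a
   nonnegative function of the replicas. *)
Definition replica_expectation (n : nat)
    (f : {ffun 'I_n -> X} -> {ffun 'I_n -> X} -> R) : \bar R :=
  (\esum_(w in [set: edge_marks n * ({ffun 'I_n -> X} * {ffun 'I_n -> X})]%classic)
     (poisson_graph_pmf w.1 *
      (canonical_measure psi (G := mgraph_of w.1) w.2.1 *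
       canonical_measure psi (G := mgraph_of w.1) w.2.2) *
      f w.2.1 w.2.2)%:E)%E.

End PoissonModel.

(* Main.v *)
Require Import Defs.
From mathcomp Require Import all_boot all_order all_algebra finmap.
From mathcomp Require Import all_classical all_reals all_analysis.
From mathcomp Require Import ring lra.
Import Order.TTheory GRing.Theory Num.Theory.
Import numFieldNormedType.Exports.
Set Implicit Arguments.
Unset Strict Implicit.
Unset Printing Implicit Defensive.
Local Open Scope classical_set_scope.
Local Open Scope ring_scope.

(** Fix a marked tree T of l generations and an injection f of its vertices into
the n vertices of the multigraph.  A multigraph g in which f(T) is exactly the
set of edges at distance less than l from the root is the sum of f(T) and of a
multigraph h without edges at the images of the vertices of depth less than l.
The Poisson weights of g and h differ by the factor [edges_factor], the product
of 2 gamma p(a) / n over the marks a of the edges of T ([graph_pmf_plant]).  An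
expectation over the g that contain f(T) is therefore at most [edges_factor]
times an expectation over the unconditioned multigraph h ([embeds_sum_le]): the
rest of the graph is compared with the Poisson multigraph on the same n vertices
by dropping the restriction on h, which has a probability bounded below.

Under the canonical measure of g, the spins on f(T) have the law that they have
under the canonical measure of h, reweighted by the edges of T.  When the latter
law is nearly uniform, the spins on f(T) nearly follow the canonical measure of
T.  By the Markov property the reconstruction distance of g at t <= l is a
function of this law ([recon_tv_pull]), and a Lipschitz one, so it is close to
the reconstruction distance of T ([recon_tv_close]).

Near uniformity on a random tuple of vertices comes from the hypothesis on the
overlap.  Averaging it over the exchange of the two replicas gives
E < O_y ^ 2 > -> 0, where O_y is the mean over the vertices of the product of
the two centred indicators of the spin y.  By a second moment computation, for
every bounded B the correlation of B with the centred indicator at a random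
vertex is then small ([centred_correlation_bound]), and in the law of a tuple
the indicators can be replaced by 1 / |X| one after the other ([decorrelate]).

A ball isomorphic to T is hit by several pairs (plane tree, injection), one for
each choice of an ordering of the children of each vertex.  Giving each pair the
weight 1 / [orderings], the total weight over a given rooted multigraph is at
most 1 ([sum_share_embeddings]), while the expected weight of the pairs with
plane tree T tends to at least the Galton-Watson probability of T
([root_share_mass_ge]).  Hence, if every multigraph whose reconstruction
distance is close to that of a tree in A belongs to B, then
P(T(l) in A) <= P(G_n in B) + o(1) ([tree_event_le_graph_event]).  This is used
for the event that the distance is at least a threshold and for its complement,
for all l >= t; since both models have total mass one, the second use is an
upper bound for the graph. *)

(* fingraph exports another rgraph. *)
Local Notation rgraph := Defs.rgraph.

(** * Sums over countable types *)

Section CountableSums.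
Variable R : realType.
Local Open Scope ereal_scope.

Lemma sum_le_esum (T : choiceType) (a : T -> \bar R) (s : seq T) :
  uniq s -> \sum_(x <- s) a x <= \esum_(x in setT) a x.
Proof.
move=> us; apply: esum_ge; exists [set` s]; first by split.
by rewrite fsbig_seq.
Qed.

Lemma esum_le_sum (T : choiceType) (a : T -> \bar R) (c : \bar R) :
  (forall s : seq T, uniq s -> \sum_(x <- s) a x <= c) ->
  \esum_(x in setT) a x <= c.
Proof.
move=> H; apply: ge_ereal_sup => _ [A [finA _] <-].
by rewrite fsbig_finite//=; apply: H; exact: fset_uniq.
Qed.

(** The inequality for sums over finite sets gives one direction for every
factor; applied to the inverse of the factor it gives the other one. *)
Lemma esumZl (T : choiceType) (c : R) (a : T -> \bar R) : (0 <= c)%R ->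
  (forall x, 0 <= a x) ->
  \esum_(x in setT) (c%:E * a x) = c%:E * \esum_(x in setT) a x.
Proof.
have le (d : R) (b : T -> \bar R) : (0 <= d)%R -> (forall x, 0 <= b x) ->
    \esum_(x in setT) (d%:E * b x) <= d%:E * \esum_(x in setT) b x.
  move=> d0 b0; apply: esum_le_sum => s us.
  rewrite -ge0_sume_distrr//; apply: lee_wpmul2l; first by rewrite lee_fin.
  exact: sum_le_esum.
move=> c0 a0; apply/eqP; rewrite eq_le le//=.
have [->|cn0] := eqVneq c 0%R.
  by rewrite mul0e; apply: esum_ge0 => x _; rewrite mul0e.
have cp : (0 < c)%R by rewrite lt_neqAle eq_sym cn0.
rewrite -[leRHS]mul1e -(divff cn0) EFinM -muleA.
apply: lee_wpmul2l; first by rewrite lee_fin.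
apply: le_trans (le _ (fun x => c%:E * a x) _ _).
- apply: le_esum => x _; rewrite muleA -EFinM mulVf// mul1e//.
- by rewrite invr_ge0.
- by move=> x; rewrite mule_ge0// lee_fin.
Qed.

Lemma esum_finType (T : finType) (a : T -> \bar R) : (forall x, 0 <= a x) ->
  \esum_(x in setT) a x = \sum_x a x.
Proof.
move=> a0; apply/eqP; rewrite eq_le sum_le_esum ?index_enum_uniq// andbT.
apply: esum_le_sum => s us; rewrite big_uniq//= [leRHS](bigID (mem s))/=.
by rewrite leeDl// sume_ge0.
Qed.

Lemma esum_pair (T1 T2 : choiceType) (a : T1 * T2 -> \bar R) :
  (forall w, 0 <= a w) ->
  \esum_(w in setT) a w = \esum_(x in setT) \esum_(y in setT) a (x, y).
Proof.
move=> a0; rewrite esum_esum//.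
rewrite (_ : _ `*`` _ = [set: T1 * T2]); last by apply/seteqP; split.
by apply: eq_esum => -[].
Qed.

Lemma esum_setE (T : choiceType) (A : T -> Prop) (f : T -> R) :
  \esum_(w in [set w | A w]) (f w)%:E =
  \esum_(w in setT) (f w * (`[< A w >])%:R)%:E.
Proof.
rewrite esum_mkcond; apply: eq_esum => w _.
case: ifPn; rewrite (inE, notin_setE) /= => Aw.
  by rewrite asboolT// mulr1.
by rewrite asboolF// mulr0.
Qed.

Lemma poisson_mass_ge0 (r : R) k : (0 <= r)%R -> (0 <= poisson_mass r k)%R.
Proof.
by move=> r0; rewrite /poisson_mass !mulr_ge0 ?expR_ge0 ?exprn_ge0 ?invr_ge0.
Qed.

Lemma poisson_mass_sum1 (r : R) : (0 <= r)%R ->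
  \esum_(k in setT) (poisson_mass r k)%:E = 1.
Proof.
move=> r0.
have e0 k : (0 <= exp_coeff r k)%R by exact: exp_coeff_ge0.
transitivity (\esum_(k in setT) ((expR (- r))%:E * (exp_coeff r k)%:E)).
  by apply: eq_esum => k _; rewrite -EFinM /poisson_mass /exp_coeff /= mulrA.
rewrite esumZl ?expR_ge0//.
rewrite -nneseries_esumT//.
have -> : \sum_(k <oo) (exp_coeff r k)%:E = (expR r)%:E.
  rewrite /expR -EFin_lim; last exact: is_cvg_series_exp_coeff.
  by congr (limn _); apply/funext => n /=; rewrite sumEFin.
by rewrite -EFinM -expRD addNr expR0.
Qed.

(** Fubini for lists whose length and whose factor at each position are
prescribed by [r].  It serves the families of lists of marks (through
[esum_ffun_prod]), the children of a vertex (through [esum_seq_poly]) and, with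
[r] an ordering of the neighbours of a vertex, the exploration of a ball. *)
Lemma esum_seq_prod (T I : choiceType) (f : I -> T -> R) (F : I -> R)
    (r : seq I) :
  (forall i t, 0 <= f i t)%R ->
  (forall i, \esum_(t in setT) (f i t)%:E = (F i)%:E) ->
  \esum_(s in [set s : seq T | size s = size r])
     (\prod_(z <- zip r s) f z.1 z.2)%:E = (\prod_(i <- r) F i)%:E.
Proof.
move=> f0 fF; elim: r => [|i r IH] /=.
  rewrite (_ : [set s : seq T | _] = [set [::]]); last first.
    by apply/seteqP; split => s /=; [case: s|move=> ->].
  by rewrite esum_set1 !big_nil// lee_fin.
rewrite (@reindex_esum _ _ _ (setT `*`` (fun=> [set s : seq T | size s = size r]))
  _ (fun w => w.1 :: w.2)); last first.
  split => /=.
  - by move=> w [_ /= ->].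
  - by move=> [a b] [c d] _ _ [-> ->].
  - by case=> [//|t s] /= [sr]; exists (t, s).
rewrite -(@esum_esum _ _ _ _ _ (fun t s => (\prod_(z <- zip (i :: r) (t :: s)) f z.1 z.2)%:E));
  last by move=> t s _ _; rewrite lee_fin prodr_ge0.
have F0 j : (0 <= F j)%R.
  by rewrite -lee_fin -fF; apply: esum_ge0 => t _; rewrite lee_fin.
rewrite big_cons mulrC EFinM -(fF i) -esumZl ?prodr_ge0//; last first.
  by move=> t; rewrite lee_fin.
apply: eq_esum => t _; rewrite muleC -IH.
rewrite [RHS](_ : _ = (f i t)%:E * \esum_(s in setT) (
  if s \in [set s : seq T | size s = size r] then
    (\prod_(z <- zip r s) f z.1 z.2)%:E else 0)); last by rewrite -esum_mkcond.
rewrite -esumZl//; last by move=> s; case: ifP => // _; rewrite lee_fin prodr_ge0.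
rewrite esum_mkcond; apply: eq_esum => s _.
by case: ifP => _; rewrite ?mule0// big_cons EFinM.
Qed.

Lemma esum_ffun_prod (T : choiceType) (I : finType) (f : I -> T -> R)
    (F : I -> R) :
  (forall i t, 0 <= f i t)%R ->
  (forall i, \esum_(t in setT) (f i t)%:E = (F i)%:E) ->
  \esum_(g in [set: {ffun I -> T}]) (\prod_i f i (g i))%:E = (\prod_i F i)%:E.
Proof.
move=> f0 fF; rewrite -[in RHS]big_enum/= -(@esum_seq_prod T I f F)//.
rewrite (@reindex_esum _ _ _ setT _ (fun g : {ffun I -> T} => codom g)); last first.
  split => /=.
  - by move=> g _ /=; rewrite size_map.
  - by move=> g h _ _; rewrite !codom_ffun => /val_inj/(congr1 (@Finfun I T)); rewrite !fgraphK.
  - move=> s /=; rewrite -cardE => /eqP hs; exists (Finfun (Tuple hs)) => //.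
    by rewrite codom_ffun FinfunK.
apply: eq_esum => g _; congr (_%:E).
rewrite /codom /image_mem (_ : zip _ _ = [seq (i, g i) | i <- enum I]).
  by rewrite big_map big_enum.
by elim: (enum I) => //= i e ->.
Qed.

Lemma esum_seq_poly (T : choiceType) (u : nat -> R) (f : T -> R) (F : R) :
  (forall k, 0 <= u k)%R -> (forall t, 0 <= f t)%R ->
  \esum_(t in setT) (f t)%:E = F%:E ->
  \esum_(s in [set: seq T]) (u (size s) * \prod_(c <- s) f c)%:E =
  \esum_(k in setT) (u k * F ^+ k)%:E.
Proof.
move=> u0 f0 fF.
have F0 : (0 <= F)%R.
  by rewrite -lee_fin -fF; apply: esum_ge0 => t _; rewrite lee_fin.
rewrite (_ : [set: seq T] = \bigcup_(k in setT) [set s : seq T | size s = k]);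
  last by apply/seteqP; split => // s _; exists (size s).
rewrite esum_bigcupT.
- apply: eq_esum => k _.
  have := @esum_seq_prod T nat (fun=> f) (fun=> F) (nseq k 0%N) (fun=> f0) (fun=> fF).
  rewrite size_nseq big_const_seq count_predT size_nseq iter_mulr_1 => H.
  rewrite EFinM -H [in RHS]esum_mkcond -esumZl//; last first.
    by move=> s; case: ifP => // _; rewrite lee_fin prodr_ge0.
  rewrite esum_mkcond; apply: eq_esum => s _.
  case: ifP => [|_]; last by rewrite mule0.
  rewrite inE/= => <-; rewrite EFinM; congr (_ * _%:E).
  rewrite -[in LHS](@unzip2_zip _ _ (nseq (size s) 0%N) s) ?size_nseq//.
  by rewrite /unzip2 big_map.
- by apply/trivIsetP => i j _ _ ij; apply/seteqP; split => // s [/= -> /eqP]; rewrite (negbTE ij).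
- by move=> s; rewrite lee_fin mulr_ge0// prodr_ge0.
Qed.

End CountableSums.

(** * Total masses of the two random models *)

Section Masses.
Variables (R : realType) (C : finType) (gamma : R) (p : C -> R).
Hypotheses (gamma_ge0 : 0 <= gamma) (p_ge0 : forall a, 0 <= p a)
  (p_sum1 : \sum_a p a = 1).

Lemma edge_rate_ge0 n (ij : vpair n) : 0 <= edge_rate gamma ij.
Proof. by rewrite /edge_rate; case: ifP => _; rewrite divr_ge0 ?mulr_ge0. Qed.

Lemma edge_mass_ge0 (r : R) (l : seq C) : 0 <= r ->
  0 <= poisson_mass r (size l) * \prod_(a <- l) p a.
Proof. by move=> r0; rewrite mulr_ge0 ?poisson_mass_ge0 ?prodr_ge0. Qed.

Lemma edge_mass_sum1 (r : R) : 0 <= r ->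
  (\esum_(l in [set: seq C])
     (poisson_mass r (size l) * \prod_(a <- l) p a)%:E = 1)%E.
Proof.
move=> r0; rewrite (@esum_seq_poly _ _ _ _ 1)//.
- rewrite -[RHS](poisson_mass_sum1 r0); apply: eq_esum => k _.
  by rewrite expr1n mulr1.
- by move=> k; rewrite poisson_mass_ge0.
- by rewrite esum_finType ?sumEFin ?p_sum1// => a; rewrite lee_fin.
Qed.

Lemma graph_pmf_ge0 n (g : edge_marks C n) : 0 <= poisson_graph_pmf gamma p g.
Proof.
by rewrite prodr_ge0// => ij _; apply: edge_mass_ge0; exact: edge_rate_ge0.
Qed.

(** The multiplicities are independent, so that the absence of edges in [D] has
the product of the probabilities of zero edges. *)
Lemma graph_pmf_avoid n (D : pred (vpair n)) :
  (\esum_(g in [set: edge_marks C n])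
     (poisson_graph_pmf gamma p g * [forall (ij | D ij), g ij == [::]]%:R)%:E =
   (\prod_(ij | D ij) expR (- edge_rate gamma ij))%:E)%E.
Proof.
pose f (ij : vpair n) (l : seq C) := poisson_mass (edge_rate gamma ij) (size l) *
  (\prod_(a <- l) p a) * (D ij ==> (l == [::]))%:R.
pose F (ij : vpair n) := if D ij then expR (- edge_rate gamma ij) else 1.
have r0 := @edge_rate_ge0 n.
have f0 ij l : 0 <= f ij l.
  by rewrite /f mulr_ge0// edge_mass_ge0.
have fF ij : (\esum_(l in setT) (f ij l)%:E = (F ij)%:E)%E.
  rewrite /f /F; case: (D ij) => /=.
    rewrite -(@esum_set1 R (seq C) [::] (fun=> (expR (- edge_rate gamma ij))%:E)).
      rewrite [RHS]esum_mkcond; apply: eq_esum => l _.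
      case: ifPn; rewrite (inE, notin_setE)/=.
        by move=> ->; rewrite eqxx mulr1 big_nil mulr1 /poisson_mass expr0 fact0 divr1 mulr1.
      by move=> /eqP/negbTE ->; rewrite mulr0.
    by rewrite lee_fin expR_ge0.
  rewrite -[RHS](edge_mass_sum1 (r0 ij)); apply: eq_esum => l _.
  by rewrite mulr1.
rewrite [in RHS]big_mkcond -(@esum_ffun_prod _ _ _ f F f0 fF).
apply: eq_esum => g _; congr (_%:E).
rewrite /f big_split/=; congr (_ * _).
case: forallP => /= H; first by rewrite big1// => ij _; rewrite H.
move/existsNP : H => [ij /negP/negbTE H].
by rewrite (bigD1 ij)//= H mul0r.
Qed.

Lemma graph_pmf_sum1 n :
  (\esum_(g in [set: edge_marks C n]) (poisson_graph_pmf gamma p g)%:E = 1)%E.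
Proof.
have := @graph_pmf_avoid n xpred0; rewrite big_pred0// => <-.
apply: eq_esum => g _; rewrite (_ : [forall (ij | _), _] = true) ?mulr1//.
by apply/forallP.
Qed.

Lemma gw_pmf_ge0 l (t : gwtree C l) : 0 <= gw_pmf gamma p t.
Proof.
elim: l t => [|l IH] t //=.
by rewrite mulr_ge0 ?poisson_mass_ge0 ?mulr_ge0// prodr_ge0// => c _; rewrite mulr_ge0.
Qed.

Lemma gw_pmf_sum1 l :
  (\esum_(t in [set: gwtree C l]) (gw_pmf gamma p t)%:E = 1)%E.
Proof.
elim: l => [|l IH].
  rewrite (@esum_finType _ unit)/=; last by move=> x; rewrite lee_fin.
  by rewrite sumEFin big_const card_unit /= addr0.
have r0 : 0 <= 2 * gamma by rewrite mulr_ge0.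
have H : (\esum_(c in [set: C * gwtree C l]) (p c.1 * gw_pmf gamma p c.2)%:E = 1%:E)%E.
  rewrite esum_pair; last by move=> c; rewrite lee_fin mulr_ge0 ?gw_pmf_ge0.
  rewrite esum_finType; last first.
    by move=> a; apply: esum_ge0 => t _; rewrite lee_fin mulr_ge0 ?gw_pmf_ge0.
  rewrite -p_sum1 -sumEFin; apply: eq_bigr => a _.
  under eq_esum do rewrite /= EFinM.
  by rewrite esumZl ?IH ?mule1// => t; rewrite lee_fin gw_pmf_ge0.
rewrite /= (@esum_seq_poly R (C * gwtree C l)%type _ _ 1)//.
- rewrite -[RHS](poisson_mass_sum1 r0); apply: eq_esum => k _.
  by rewrite expr1n mulr1.
- by move=> k; rewrite poisson_mass_ge0.
- by move=> c; rewrite mulr_ge0 ?gw_pmf_ge0.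
Qed.

End Masses.

(** * Decorrelation from the overlap of two replicas *)

Section Decorrelation.
Variables (R : realType) (X I : finType).
Variable q : {ffun I -> X} -> R.
Hypotheses (q_ge0 : forall x, 0 <= q x) (q_sum1 : \sum_x q x = 1).
Hypothesis I_gt0 : (0 < #|I|)%N.

Local Notation n := (#|I|%:R : R).

Definition centred (y : X) (x : {ffun I -> X}) (i : I) : R :=
  (x i == y)%:R - #|X|%:R^-1.

Definition overlap (y : X) (x x' : {ffun I -> X}) : R :=
  n^-1 * \sum_i centred y x i * centred y x' i.

Definition overlap_moment (y : X) : R :=
  \sum_x \sum_x' q x * q x' * overlap y x x' ^+ 2.

Lemma overlap_moment_ge0 y : 0 <= overlap_moment y.
Proof.
apply: sumr_ge0 => x _; apply: sumr_ge0 => x' _.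
by rewrite mulr_ge0 ?sqr_ge0 ?mulr_ge0.
Qed.

Lemma abs_le_sqr (k a : R) : 0 < k -> `|a| <= k + a ^+ 2 / k.
Proof.
move=> k0; rewrite -(real_normK (num_real a)); have := normr_ge0 a.
move: (`|a|) => b b0; rewrite -(ler_pM2r k0) mulrDl mulfVK ?gt_eqF//.
by have := sqr_ge0 (b - k); nra.
Qed.

(** Let a_i be the correlation of [B] with the centred indicator at i.  Expanding
the square with two replicas, the sum of the a_i ^ 2 is n times the mean of
B B' O_y, hence at most n < |O_y| >.  The absolute values are bounded by squares
through |a| <= k + a ^ 2 / k, at scale [k] for a_i and [k ^ 2] for O_y.  This
keeps the bound affine in the moment of the overlap, which is what remains
computable after taking the expectation over the multigraph. *)
Lemma centred_correlation_bound (k : R) (y : X) (B : {ffun I -> X} -> R) :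
  0 < k -> (forall x, `|B x| <= 1) ->
  \sum_i `|\sum_x q x * (B x * centred y x i)| <=
  n * (2 * k + overlap_moment y / k ^+ 3).
Proof.
move=> k0 B1; set a := fun i => \sum_x q x * (B x * centred y x i).
have n0 : 0 < n by rewrite ltr0n.
have sq : \sum_i a i ^+ 2 <= n * (k ^+ 2 + overlap_moment y / k ^+ 2).
  have -> : \sum_i a i ^+ 2 =
      n * \sum_x \sum_x' q x * q x' * (B x * B x' * overlap y x x').
    transitivity (\sum_i \sum_x \sum_x' (q x * (B x * centred y x i)) *
        (q x' * (B x' * centred y x' i))).
      apply: eq_bigr => i _; rewrite expr2 /a mulr_suml.
      by apply: eq_bigr => x _; rewrite mulr_sumr.
    rewrite exchange_big mulr_sumr; apply: eq_bigr => x _.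
    rewrite exchange_big mulr_sumr; apply: eq_bigr => x' _.
    rewrite /overlap 2!(mulrCA n) mulVKf ?gt_eqF// !mulr_sumr.
    by apply: eq_bigr => i _; ring.
  rewrite ler_wpM2l ?(ltW n0)//.
  have -> : k ^+ 2 + overlap_moment y / k ^+ 2 =
     \sum_x \sum_x' q x * q x' * (k ^+ 2 + overlap y x x' ^+ 2 / k ^+ 2).
    transitivity (\sum_x \sum_x' (q x * q x' * k ^+ 2 +
        q x * q x' * overlap y x x' ^+ 2 / k ^+ 2)); last first.
      by apply: eq_bigr => x _; apply: eq_bigr => x' _; rewrite mulrDr mulrA.
    transitivity (\sum_x (q x * k ^+ 2 +
      (\sum_x' q x * q x' * overlap y x x' ^+ 2) / k ^+ 2)).
      by rewrite big_split/= -!mulr_suml q_sum1 mul1r.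
    apply: eq_bigr => x _; rewrite big_split/= -!mulr_suml -mulr_sumr.
    by rewrite q_sum1 mulr1.
  apply: ler_sum => x _; apply: ler_sum => x' _.
  rewrite ler_wpM2l ?mulr_ge0//; apply: le_trans (ler_norm _) _.
  apply: le_trans (abs_le_sqr _ (exprn_gt0 2 k0)).
  rewrite !normrM -[leRHS]mul1r ler_wpM2r// -[leRHS]mulr1.
  by rewrite ler_pM.
apply: (@le_trans _ _ (\sum_i (k + a i ^+ 2 / k))).
  by apply: ler_sum => i _; exact: abs_le_sqr.
rewrite big_split/= sumr_const -[k *+ _]mulr_natl -mulr_suml.
rewrite (_ : n * (2 * k + _) =
    n * k + n * (k ^+ 2 + overlap_moment y / k ^+ 2) / k); last first.
  by field; rewrite gt_eqF.
by rewrite lerD2l ler_wpM2r ?invr_ge0 ?(ltW k0).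
Qed.

Section Resampling.
Variable V : finType.
Implicit Types (f : {ffun V -> I}).

Definition upd f (v : V) (i : I) : {ffun V -> I} :=
  [ffun u => if u == v then i else f u].

(** Redrawing the label of one vertex does not change a sum over all labellings:
exchanging the drawn label with the current one is an involution. *)
Lemma resample (F : {ffun V -> I} -> R) (v : V) :
  n * \sum_f F f = \sum_f \sum_i F (upd f v i).
Proof.
rewrite pair_bigA/=.
pose h (w : {ffun V -> I} * I) := (upd w.1 v w.2, w.1 v).
have hK : involutive h.
  move=> [f i]; rewrite /h/=; congr pair; last by rewrite ffunE eqxx.
  by apply/ffunP => u; rewrite !ffunE; case: eqP => // ->.
rewrite (reindex_inj (inv_inj hK))/=.
have -> : \sum_j F (upd (upd j.1 v j.2) v (j.1 v)) = \sum_(j : {ffun V -> I} * I) F j.1.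
  by apply: eq_bigr => j _; have := hK j; rewrite /h/= => /(congr1 fst)/= ->.
rewrite -(pair_bigA _ (fun f _ => F f))/= mulr_sumr; apply: eq_bigr => f _.
by rewrite sumr_const mulr_natl.
Qed.

Variables (e : R) (y : V -> X).
Hypothesis one_site : forall (z : X) (B : {ffun I -> X} -> R),
  (forall x, `|B x| <= 1) ->
  \sum_i `|\sum_x q x * (B x * centred z x i)| <= n * e.

(** The indicators are replaced one at a time by their mean value under the
uniform law.  [B] collects the indicators that are already frozen; since it
depends on the labels outside [s] only, the label of the vertex being treated
can be resampled. *)
Lemma decorrelate (s : seq V) (B : {ffun V -> I} -> {ffun I -> X} -> R) :
  uniq s -> (forall f x, `|B f x| <= 1) ->
  (forall v f i, v \in s -> B (upd f v i) = B f) ->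
  \sum_f `| \sum_x q x * (B f x * \prod_(v <- s) (x (f v) == y v)%:R)
            - #|X|%:R^-1 ^+ size s * \sum_x q x * B f x |
    <= (size s)%:R * (n ^+ #|V| * e).
Proof.
have n0 : 0 < n by rewrite ltr0n.
elim: s B => [|v s IH] B /=.
  move=> _ _ _; rewrite mul0r big1// => f _; rewrite expr0 mul1r.
  apply/eqP; rewrite normr_eq0 subr_eq0; apply/eqP; apply: eq_bigr => x _.
  by rewrite big_nil mulr1.
move=> /andP[vs us] B1 Bs; set c := #|X|%:R^-1.
pose B' (f : {ffun V -> I}) (x : {ffun I -> X}) := B f x * (x (f v) == y v)%:R.
have B'1 f x : `|B' f x| <= 1.
  by rewrite normrM; apply: mulr_ile1 => //; case: (_ == _); rewrite ?normr1 ?normr0.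
have B's u f i : u \in s -> B' (upd f u i) = B' f.
  move=> us'; apply/funext => x; rewrite /B' Bs ?inE ?us' ?orbT// ffunE.
  by case: (v =P u) => // vu; rewrite vu us' in vs.
have {IH} IH := IH B' us B'1 B's.
have c01 : 0 <= c ^+ size s <= 1.
  rewrite exprn_ge0 ?invr_ge0//=; apply: exprn_ile1; rewrite ?invr_ge0//.
  rewrite /c; case: #|X| => [|k]; first by rewrite invr0 ler01.
  by rewrite invf_le1 ?ltr0n// ler1n.
have step : \sum_f `|\sum_x q x * (B f x * centred (y v) x (f v))| <= n ^+ #|V| * e.
  rewrite -(ler_pM2l n0) (resample _ v).
  have -> : n * (n ^+ #|V| * e) = \sum_(f : {ffun V -> I}) n * e.
    by rewrite sumr_const card_ffun -[in RHS](mulr_natl _ (_ ^ _)) natrX mulrCA.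
  apply: ler_sum => f _; apply: le_trans (one_site (y v) (B1 f)).
  apply: ler_sum => i _; rewrite Bs ?mem_head//.
  by under eq_bigr do rewrite ffunE eqxx.
rewrite -natr1 mulrDl mul1r.
apply: le_trans (lerD IH step); rewrite -big_split/=; apply: ler_sum => f _.
set a := \sum_x q x * (B f x * centred _ _ _).
set b := \sum_x q x * B' f x; set d := \sum_x q x * B f x.
have ->: a = b - c * d.
  rewrite /a /b /d mulr_sumr -sumrB; apply: eq_bigr => x _.
  by rewrite /B' /centred -/c; ring.
have -> : \sum_x q x * (B f x * \prod_(w <- v :: s) (x (f w) == y w)%:R) =
   \sum_x q x * (B' f x * \prod_(w <- s) (x (f w) == y w)%:R).
  by apply: eq_bigr => x _; rewrite big_cons /B' -[in RHS](mulrA (B f x)).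
set g := \sum_x _ * _ .
rewrite (_ : _ - _ = (g - c ^+ size s * b) + c ^+ size s * (b - c * d)); last first.
  by rewrite exprS; ring.
apply: le_trans (ler_normD _ _) _; rewrite lerD2l normrM ger0_norm; last by case/andP: c01.
by rewrite ler_piMl//; case/andP: c01.
Qed.

End Resampling.

Lemma sampled_law_near_uniform (V : finType) (k : R) (y : {ffun V -> X}) : 0 < k ->
  \sum_(f : {ffun V -> I})
     `|law_of q (fun x => [ffun v => x (f v)]) y - #|X|%:R^-1 ^+ #|V| |
  <= #|V|%:R * (n ^+ #|V| * (2 * k + (\sum_z overlap_moment z) / k ^+ 3)).
Proof.
move=> k0; set e := 2 * k + _.
have n0 : 0 < n by rewrite ltr0n.
have os (z : X) (B : {ffun I -> X} -> R) : (forall x, `|B x| <= 1) ->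
    \sum_i `|\sum_x q x * (B x * centred z x i)| <= n * e.
  move=> B1; apply: le_trans (centred_correlation_bound z k0 B1) _.
  rewrite ler_wpM2l ?(ltW n0)// lerD2l ler_wpM2r ?invr_ge0 ?exprn_ge0 ?(ltW k0)//.
  by rewrite (bigD1 z)//= lerDl sumr_ge0// => ? _; exact: overlap_moment_ge0.
have B1 : forall (f : {ffun V -> I}) (x : {ffun I -> X}), `|1 : R| <= 1.
  by move=> *; rewrite normr1.
have := @decorrelate V e y os (enum V) _ (enum_uniq _) B1 (fun _ _ _ _ => erefl).
rewrite -cardE; apply: le_trans; apply: ler_sum => f _.
under [X in _ * X]eq_bigr do rewrite mulr1.
rewrite q_sum1 mulr1 /law_of big_mkcond/=.
rewrite le_eqVlt; apply/orP; left; apply/eqP; congr (`|_ - _|).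
apply: eq_bigr => x _; rewrite mul1r big_enum /=.
case: eqP => [<-|ne].
  by rewrite big1 ?mulr1// => v _; rewrite ffunE eqxx.
have [v /eqP nv] : exists v, x (f v) <> y v.
  by apply/existsNP => H; apply: ne; apply/ffunP => v; rewrite ffunE.
by rewrite (bigD1 v)//= (negbTE nv) mul0r mulr0.
Qed.

End Decorrelation.

Section OverlapType.
Variables (R : realType) (X : finType) (n : nat).
Hypothesis n_gt0 : (0 < n)%N.

Definition overlap_defect (y : X) (x1 x2 : {ffun 'I_n -> X}) : R :=
  delta_type R x1 x2 y y - 2 * #|X|%:R^-1 * \sum_x' delta_type R x1 x2 y x'.

(** The defect subtracts twice the marginal of the first replica; the exchange of
the replicas turns this into the sum of both marginals, which is what the
product of the two centred indicators produces. *)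
Lemma overlap_symm_defect y x1 x2 :
  overlap R y x1 x2 = 2^-1 * (overlap_defect y x1 x2 + overlap_defect y x2 x1).
Proof.
have n0 : n%:R != 0 :> R by rewrite pnatr_eq0 -lt0n.
have X0 : #|X|%:R != 0 :> R by rewrite pnatr_eq0 -lt0n; apply/card_gt0P; exists y.
have tt (u v : {ffun 'I_n -> X}) z :
    two_type R u v y z = n%:R^-1 * \sum_i (u i == y)%:R * (v i == z)%:R.
  rewrite /two_type mulrC; congr (_ * _); rewrite -sum1_card natr_sum big_mkcond.
  by apply: eq_bigr => i _; rewrite inE; do 2!case: (_ == _); rewrite /= ?mulr1 ?mulr0.
have row (u v : {ffun 'I_n -> X}) : \sum_x' delta_type R u v y x' =
    n%:R^-1 * (\sum_i (u i == y)%:R) - #|X|%:R^-1.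
  rewrite /delta_type sumrB; congr (_ - _).
    under eq_bigr do rewrite tt.
    rewrite -mulr_sumr exchange_big; congr (_ * _); apply: eq_bigr => i _.
    rewrite -mulr_sumr (bigD1 (v i))//= eqxx big1 ?addr0 ?mulr1// => z.
    by rewrite eq_sym => /negbTE ->.
  by rewrite sumr_const -[_ *+ _]mulr_natl; field.
rewrite /overlap_defect !row /delta_type !tt /overlap card_ord.
have -> : \sum_i centred R y x1 i * centred R y x2 i =
   (\sum_i (x1 i == y)%:R * (x2 i == y)%:R) - #|X|%:R^-1 * (\sum_i (x1 i == y)%:R)
   - #|X|%:R^-1 * (\sum_i (x2 i == y)%:R) + n%:R * #|X|%:R^-2.
  transitivity (\sum_(i < n) ((x1 i == y)%:R * (x2 i == y)%:R
      - #|X|%:R^-1 * (x1 i == y)%:R - #|X|%:R^-1 * (x2 i == y)%:R + (#|X|%:R : R)^-2)).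
    by apply: eq_bigr => i _; rewrite /centred -exprVn; ring.
  by rewrite !big_split/= !sumrN sumr_const card_ord -!mulr_sumr -[_ *+ n]mulr_natl.
have -> : \sum_i (x2 i == y)%:R * (x1 i == y)%:R = \sum_i (x1 i == y)%:R * (x2 i == y)%:R :> R.
  by apply: eq_bigr => i _; rewrite mulrC.
by field; rewrite n0 X0.
Qed.

Lemma overlap_moment_le_defect (q : {ffun 'I_n -> X} -> R) y :
  (forall x, 0 <= q x) ->
  overlap_moment q y <= \sum_x1 \sum_x2 q x1 * q x2 * overlap_defect y x1 x2 ^+ 2.
Proof.
move=> q0; set D := leRHS.
have -> : D = 2^-1 * (D + \sum_x1 \sum_x2 q x1 * q x2 * overlap_defect y x2 x1 ^+ 2).
  have <- : D = \sum_x1 \sum_x2 q x1 * q x2 * overlap_defect y x2 x1 ^+ 2.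
    rewrite exchange_big; apply: eq_bigr => x _; apply: eq_bigr => x' _.
    by rewrite (mulrC (q x')).
  by rewrite -mulr2n -[D *+ 2]mulr_natl mulKf// pnatr_eq0.
rewrite -big_split/= mulr_sumr; apply: ler_sum => x _.
rewrite -big_split/= mulr_sumr; apply: ler_sum => x' _.
rewrite -mulrDr (mulrCA 2^-1) ler_wpM2l ?mulr_ge0// overlap_symm_defect.
set a := overlap_defect _ _ _; set b := overlap_defect _ _ _.
have := sqr_ge0 (a - b); nra.
Qed.

End OverlapType.

(** * Depth and weight of a Galton-Watson tree *)

Lemma big_option (S : Type) (idx : S) (op : Monoid.com_law idx) (T : finType)
    (F : option T -> S) :
  \big[op/idx]_(v : option T) F v = op (F None) (\big[op/idx]_u F (Some u)).
Proof.
rewrite (bigD1 None)//=; congr (op _ _).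
rewrite (reindex_omap Some id); last by case.
by apply: eq_bigl => u; rewrite eqxx.
Qed.

Section RootedTrees.
Variable C : finType.

(** The edges point from parent to child: each vertex other than the root is the
child of exactly one edge. *)
Definition is_depth (G : rgraph C) (l : nat) (d : vert G -> nat) : Prop :=
  [/\ d (groot G) = 0%N,
      {in edges G, forall e, d e.1.2 = (d e.1.1).+1},
      (forall v, d v <= l)%N &
      perm_eq (groot G :: [seq e.1.2 | e <- edges G]) (enum (vert G))].

Section Depth.
Variables (G : rgraph C) (l : nat) (d : vert G -> nat).
Hypothesis dP : is_depth l d.

Lemma card_vert_tree : #|vert G| = (size (edges G)).+1.
Proof. by case: dP => _ _ _ /perm_size; rewrite /= size_map -cardE. Qed.

Lemma uniq_children : uniq [seq e.1.2 | e <- edges G].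
Proof.
case: dP => _ _ _ /perm_uniq; rewrite enum_uniq /=.
by case/andP.
Qed.

Lemma child_inj : {in edges G &, injective (fun e => e.1.2)}.
Proof.
move=> e e' eG e'G E; have u := uniq_children.
move: (eG) (e'G) => /(nth_index e) <- /(nth_index e) <-.
move: eG e'G; rewrite -!index_mem => eG e'G.
have := E; rewrite -{1}(nth_index e (s := edges G) (x := e)) -?index_mem//.
rewrite -{1}(nth_index e (s := edges G) (x := e')) -?index_mem//.
rewrite -!(nth_map e (groot G) (fun e => e.1.2))// => /eqP.
by rewrite nth_uniq ?size_map// => /eqP ->.
Qed.

Lemma parent_edge v : v != groot G -> exists2 e, e \in edges G & e.1.2 = v.
Proof.
move=> vr; have [_ _ _ /perm_mem/(_ v)] := dP.
rewrite mem_enum !inE (negbTE vr)/= => /mapP[e eG ->]; by exists e.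
Qed.

Lemma adjP (u v : vert G) :
  reflect (exists2 e, e \in edges G & e.1 = (u, v) \/ e.1 = (v, u)) (adj u v).
Proof.
apply: (iffP hasP) => -[e eG].
  by case/orP => /eqP; exists e => //; [left|right].
by move=> E; exists e => //; case: E => ->; rewrite eqxx ?orbT.
Qed.

Lemma adj_depth (u v : vert G) : adj u v -> (d v <= (d u).+1)%N.
Proof.
by case: dP => _ ds _ _ /adjP[e /ds + [] E]; rewrite E /= => ->; rewrite ?leqnn ?leqW.
Qed.

Lemma path_depth w (u : vert G) : path (@adj C G) u w ->
  (d (last u w) <= d u + size w)%N.
Proof.
elim: w u => [|v w IH] u /=; first by rewrite addn0.
by move=> /andP[/adj_depth duv /IH dw]; rewrite (leq_trans dw)// addnS -addSn leq_add2r.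
Qed.

Lemma path_to (v : vert G) :
  exists w, [/\ size w = d v, path (@adj C G) (groot G) w & last (groot G) w = v].
Proof.
have [n] := ubnP (d v); elim: n v => // n IH v.
have [->|vr] := eqVneq v (groot G).
  by exists [::]; case: dP => ->.
have [e eG <-] := parent_edge vr.
have [_ ds _ _] := dP; rewrite ds// ltnS => /IH[w [ws pw lw]].
exists (rcons w e.1.2); rewrite size_rcons ws last_rcons rcons_path pw lw.
split => //=; apply/adjP; exists e => //; left; by case: (e.1).
Qed.

Lemma mem_far t (v : vert G) : (v \in far G t) = (t <= d v)%N.
Proof.
rewrite inE leqNgt; congr (~~ _); apply/existsP/idP => /=.
  move=> [k /existsP[w /andP[pw /eqP <-]]].
  have := path_depth pw; case: dP => -> _ _ _; rewrite add0n size_tuple.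
  by move=> /leq_ltn_trans; apply.
move=> dt; have [w [ws pw lw]] := path_to v.
exists (Ordinal dt); apply/existsP.
have h : size w == Ordinal dt by rewrite ws.
by exists (Tuple h); rewrite /= pw lw eqxx.
Qed.

End Depth.

Fixpoint gwdepth (l : nat) : forall t : gwtree C l, vert (gwgraph t) -> nat :=
  match l return forall t : gwtree C l, vert (gwgraph t) -> nat with
  | 0 => fun _ _ => 0%N
  | l'.+1 => fun t v =>
      if v is Some w then (gwdepth (tagged w)).+1 else 0%N
  end.

Lemma gwdepthP l (t : gwtree C l) : is_depth l (@gwdepth l t).
Proof.
elim: l t => [|l IH] t.
  split=> //=; apply: uniq_perm => //; first exact: enum_uniq.
  by case; rewrite mem_enum.
set G := gwgraph t.
pose Gi (i : 'I_(size t)) := gwgraph (tnth (in_tuple t) i).2.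
pose V i := vert (Gi i).
split => //.
- move=> e /flattenP[s /mapP[i _ ->]]; rewrite inE => /orP[/eqP ->|/mapP[f fG ->]] /=.
    by have [-> _ _ _] := IH (tnth (in_tuple t) i).2.
  have [_ ds _ _] := IH (tnth (in_tuple t) i).2.
  by rewrite (ds f fG).
- by case=> //= -[i v] /=; rewrite ltnS; have [_ _ -> _] := IH (tnth (in_tuple t) i).2.
- have E : perm_eq [seq e.1.2 | e <- edges G]
     [seq Some (Tagged V v) | i <- enum 'I_(size t), v <- enum (V i)].
    rewrite [edges G]/(edges _)/= map_flatten -map_comp.
    elim: (enum _) => //= i s IHs; rewrite -cat_cons; apply: perm_cat => //.
    have [_ _ _ /(perm_map (fun v => Some (Tagged V v)))] := IH (tnth (in_tuple t) i).2.
    by rewrite /= -!map_comp.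
  rewrite (perm_trans (_ : perm_eq _
    (None :: [seq Some (Tagged V v) | i <- enum 'I_(size t), v <- enum (V i)])))//.
    by rewrite perm_cons.
  apply: uniq_perm; last 1 first.
  + case=> [[i v]|]; rewrite mem_enum !inE//=.
    by apply/allpairsPdep; exists i, v; rewrite !mem_enum.
  + rewrite /=; apply/andP; split; first by apply/negP => /allpairsPdep[? [? []]].
    apply: allpairs_uniq_dep; first exact: enum_uniq.
      by move=> i _; exact: enum_uniq.
    by move=> [i v] [j w] _ _ /= [].
  + exact: enum_uniq.
Qed.

(** The number of labelled plane trees that present one and the same labelled ball,
each of which therefore counts for its inverse.  The Poisson weights of the
numbers of children contain the same factorials. *)
Fixpoint orderings (l : nat) : gwtree C l -> nat :=
  match l return gwtree C l -> nat with
  | 0 => fun _ => 1%N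
  | l'.+1 => fun t => ((size t)`! * \prod_(c <- t) orderings c.2)%N
  end.

Lemma orderings_gt0 l (t : gwtree C l) : (0 < orderings t)%N.
Proof.
elim: l t => //= l IH t; rewrite muln_gt0 fact_gt0/=.
by apply: prodn_gt0 => c; exact: IH.
Qed.

Variables (R : realType) (gamma : R) (p : C -> R).

Lemma gw_pmf_edges l (t : gwtree C l) :
  gw_pmf gamma p t * (orderings t)%:R =
  \prod_(e <- edges (gwgraph t)) (2 * gamma * p e.2) *
  \prod_(v : vert (gwgraph t) | (gwdepth v < l)%N) expR (- (2 * gamma)).
Proof.
elim: l t => [|l IH] t.
  by rewrite /= big_nil big_pred0// !mulr1.
pose Gi (i : 'I_(size t)) := gwgraph (tnth (in_tuple t) i).2.
pose D i (v : vert (Gi i)) : R :=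
   if (gwdepth v < l)%N then expR (- (2 * gamma)) else 1.
have -> : \prod_(v : vert (gwgraph t) | (gwdepth v < l.+1)%N) expR (- (2 * gamma)) =
    expR (- (2 * gamma)) * \prod_i \prod_v D i v.
  rewrite big_mkcond (@big_option _ _ _ {i : 'I_(size t) & vert (Gi i)})/=.
  by congr (_ * _); rewrite (sig_big_dep _ (fun _ _ => true) D)/=; apply: eq_bigr.
rewrite /= big_flatten/= big_map big_enum/=.
rewrite /poisson_mass natrM natr_prod.
have -> : expR (- (2 * gamma)) * (2 * gamma) ^+ size t / (size t)`!%:R *
  \prod_(c <- t) (p c.1 * gw_pmf gamma p c.2) *
  ((size t)`!%:R * \prod_(i <- t) (orderings i.2)%:R) =
  expR (- (2 * gamma)) * \prod_(c <- t)
    ((2 * gamma * p c.1) * (gw_pmf gamma p c.2 * (orderings c.2)%:R)).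
  rewrite [in RHS](eq_bigr (fun c =>
    2 * gamma * (p c.1 * gw_pmf gamma p c.2 * (orderings c.2)%:R))); last first.
    by move=> c _; rewrite !mulrA.
  rewrite [in RHS]big_split/= [in RHS]big_const_seq count_predT iter_mulr_1.
  rewrite !big_split/=.
  have := fact_gt0 (size t); rewrite lt0n => f0; field.
  by rewrite pnatr_eq0.
rewrite mulrCA; congr (_ * _).
rewrite big_tnth.
rewrite -big_split/=; apply: eq_bigr => i _.
by rewrite big_cons big_map /= IH /D -big_mkcond mulrA.
Qed.

End RootedTrees.

(** * Planting a tree in the Poisson multigraph *)

Section UnorderedPairs.
Variable n : nat.
Implicit Types i j : 'I_n.

Lemma upair_subproof i j :
  let w := if (i <= j)%N then (i, j) else (j, i) in (w.1 <= w.2)%N.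
Proof. by case: (leqP i j) => //= /ltnW. Qed.

Definition upair i j : vpair n := 
  exist (fun ij : 'I_n * 'I_n => (ij.1 <= ij.2)%N : Prop) _ (upair_subproof i j).

Lemma val_upair i j : val (upair i j) = if (i <= j)%N then (i, j) else (j, i).
Proof. by []. Qed.

Lemma upairC i j : upair i j = upair j i.
Proof.
apply: val_inj; rewrite !val_upair.
by case: ltngtP => // /val_inj ->.
Qed.

Lemma upairE (ij : vpair n) : ij = upair (val ij).1 (val ij).2.
Proof. by apply: val_inj; rewrite val_upair (valP ij) -surjective_pairing. Qed.

Lemma upair_eq i j k l : upair i j = upair k l ->
  (i, j) = (k, l) \/ (i, j) = (l, k).
Proof.
move/(congr1 val); rewrite !val_upair.
by case: ifP => _; case: ifP => _ [-> ->]; [left|right|right|left].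
Qed.

End UnorderedPairs.

Section Planting.
Variables (C : finType) (n l : nat) (G : rgraph C) (d : vert G -> nat).
Hypothesis dP : is_depth l d.
Implicit Types (g h : edge_marks C n) (f : {ffun vert G -> 'I_n}).

Definition edge_pair f (e : vert G * vert G * C) : vpair n :=
  upair (f e.1.1) (f e.1.2).

(** With [par] absent, the edges of [g] at distance less than [l] from the root
form the image of the tree under [f].  A subtree hanging from a vertex satisfies
the same condition up to the edge that joins this vertex to its parent [par]. *)
Definition embeds (par : option 'I_n) g f : Prop :=
  [/\ injective f, (forall v, par <> Some (f v)),
      {in edges G, forall e, g (edge_pair f e) = [:: e.2]} &
      forall v j, (d v < l)%N -> g (upair (f v) j) != [::] ->
        (exists2 u, j = f u & adj v u) \/ (v = groot G /\ par = Some j)].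

(** The pairs at which the multigraph is determined by the planted tree: those
with one end at the image of a vertex whose children are visible. *)
Definition touches f (ij : vpair n) : bool :=
  [exists v, (d v < l)%N && [exists j, ij == upair (f v) j]].

Definition planted f (ij : vpair n) : seq C :=
  [seq e.2 | e <- edges G & edge_pair f e == ij].

Definition plant f h : edge_marks C n := [ffun ij => planted f ij ++ h ij].

Definition strip f g : edge_marks C n :=
  [ffun ij => if touches f ij then [::] else g ij].

Definition avoids f h : bool := [forall (ij | touches f ij), h ij == [::]].

Lemma touchesP f ij :
  reflect (exists v j, (d v < l)%N /\ ij = upair (f v) j) (touches f ij).
Proof.
apply: (iffP existsP) => [[v /andP[dv /existsP[j /eqP ->]]]|[v [j [dv ->]]]].
  by exists v, j.
by exists v; rewrite dv; apply/existsP; exists j.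
Qed.

Lemma avoidsP f h : reflect (forall ij, touches f ij -> h ij = [::]) (avoids f h).
Proof.
apply: (iffP forallP) => H ij; last by apply/implyP => /H ->.
by move=> t; have /implyP/(_ t)/eqP := H ij.
Qed.

Lemma strip_avoids f g : avoids f (strip f g).
Proof. by apply/avoidsP => ij t; rewrite ffunE t. Qed.

Lemma edge_neq e : e \in edges G -> e.1.1 != e.1.2.
Proof.
case: dP => _ ds _ _ /ds E; apply/eqP => /(congr1 d); rewrite E.
by move/eqP; rewrite -[X in X == _]addn0 -addn1 eqn_add2l.
Qed.

Lemma edge_pair_touches f e : e \in edges G -> touches f (edge_pair f e).
Proof.
case: dP => _ ds dl _ /ds E; apply/touchesP; exists e.1.1, (f e.1.2).
by rewrite -ltnS -E ltnS dl.
Qed.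

Lemma edge_pair_inj f : injective f -> {in edges G &, injective (edge_pair f)}.
Proof.
move=> fI e e' eG e'G /upair_eq [] [/fI E1 /fI E2]; first exact: (child_inj dP).
case: dP => _ ds _ _; have := ds _ eG; have := ds _ e'G.
by rewrite -E1 -E2 => -> /eqP; rewrite -[X in X == _]addn0 -addn2 eqn_add2l.
Qed.

Lemma planted_edge f e : injective f -> e \in edges G ->
  planted f (edge_pair f e) = [:: e.2].
Proof.
move=> fI eG; rewrite /planted (eq_in_filter (a2 := pred1 e)).
  rewrite filter_pred1_uniq//.
  exact: map_uniq (uniq_children dP).
by move=> e' e'G /=; apply/eqP/eqP => [/(edge_pair_inj fI)|->]; [apply|].
Qed.

Lemma planted_nil f ij : ~~ touches f ij -> planted f ij = [::].
Proof.
move=> t; rewrite /planted (eq_in_filter (a2 := pred0)) ?filter_pred0// => e eG.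
by apply/negbTE; apply: contraNN t => /eqP <-; exact: edge_pair_touches.
Qed.

Lemma planted_mem f ij : planted f ij != [::] ->
  exists2 e, e \in edges G & ij = edge_pair f e.
Proof.
rewrite /planted; case E: [seq _ <- _ | _] => [//|e s] _.
have : e \in [seq e <- edges G | edge_pair f e == ij] by rewrite E mem_head.
by rewrite mem_filter => /andP[/eqP <- eG]; exists e.
Qed.

Lemma embeds_plant f h : injective f -> avoids f h -> embeds None (plant f h) f.
Proof.
move=> fI /avoidsP hv; split => // [e eG|v j dv].
  by rewrite ffunE planted_edge// hv// edge_pair_touches.
rewrite ffunE hv ?cats0; last by apply/touchesP; exists v, j.
move=> /planted_mem[e eG /upair_eq []] [/fI E1 E2]; left.
  by exists e.1.2 => //; apply/adjP; exists e; rewrite // E1; left; case: (e.1).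
by exists e.1.1 => //; apply/adjP; exists e; rewrite // E1; right; case: (e.1).
Qed.

Lemma plant_strip f g : embeds None g f -> plant f (strip f g) = g.
Proof.
move=> [fI _ gE gN]; apply/ffunP => ij; rewrite !ffunE.
case: (boolP (touches f ij)) => t; last by rewrite planted_nil.
rewrite cats0; case: (eqVneq (planted f ij) [::]) => [p0|].
  rewrite p0; apply/esym/eqP; apply: contraTT isT => gn.
  have [v [j [dv E]]] := touchesP _ _ t.
  have [|[u ju /adjP[e eG eE]]|[]//] := gN v j dv; first by rewrite -E.
  have := planted_edge fI eG.
  suff -> : edge_pair f e = ij by rewrite p0.
  by rewrite E ju /edge_pair; case: eE => -> //=; exact: upairC.
by move=> /planted_mem[e eG ->]; rewrite planted_edge// gE.
Qed.

Lemma strip_plant f h : avoids f h -> strip f (plant f h) = h.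
Proof.
move=> /avoidsP hv; apply/ffunP => ij; rewrite !ffunE.
by case: ifPn => t; [rewrite hv|rewrite planted_nil].
Qed.

Variables (R : realType) (gamma : R) (p : C -> R).
Hypotheses (gamma_ge0 : 0 <= gamma) (p_ge0 : forall a, 0 <= p a)
  (p_sum1 : \sum_a p a = 1).

Definition edges_factor : R := \prod_(e <- edges G) (2 * gamma / n%:R * p e.2).

Lemma edges_factor_ge0 : 0 <= edges_factor.
Proof. by rewrite prodr_ge0// => e _; rewrite !mulr_ge0. Qed.

(** The pairs joined by an edge of the tree have multiplicity 1 instead of 0, and
their two ends differ, so each of them contributes its rate 2 gamma / n times
the probability of its mark. *)
Lemma graph_pmf_plant f h : injective f -> avoids f h ->
  poisson_graph_pmf gamma p (plant f h) =
  edges_factor * poisson_graph_pmf gamma p h.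
Proof.
move=> fI /avoidsP hv.
have -> : edges_factor =
    \prod_(ij : vpair n) \prod_(a <- planted f ij) (2 * gamma / n%:R * p a).
  rewrite /edges_factor; under [RHS]eq_bigr do rewrite big_map big_filter.
  rewrite (exchange_big_dep xpredT)//=; apply: eq_bigr => e _.
  by rewrite (big_pred1 (edge_pair f e)).
rewrite /poisson_graph_pmf -big_split/=; apply: eq_bigr => ij _.
rewrite ffunE; case: (eqVneq (planted f ij) [::]) => [->|].
  by rewrite big_nil mul1r.
move=> /planted_mem[e eG ->]; rewrite planted_edge// hv ?edge_pair_touches//=.
rewrite !big_cons !big_nil !mulr1 /poisson_mass expr1 expr0 fact0 !divr1 mulr1.
rewrite [X in _ * X * _](_ : _ = 2 * gamma / n%:R); first by rewrite -mulrA mulrC.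
rewrite /edge_rate /edge_pair val_upair; case: ifP => // /eqP.
by case: ifP => _ /= /fI /eqP; rewrite ?(negbTE (edge_neq eG))// eq_sym (negbTE (edge_neq eG)).
Qed.

Lemma esum_embeds f (F : edge_marks C n -> \bar R) : injective f ->
  (\esum_(g in [set g | embeds None g f]) F g =
   \esum_(h in [set h | avoids f h]) F (plant f h))%E.
Proof.
move=> fI; apply: reindex_esum; split => /=.
- by move=> h /= hv; exact: embeds_plant.
- move=> h h'; rewrite !inE => hv h'v E.
  by rewrite -(strip_plant hv) E strip_plant.
- by move=> g /= gE; exists (strip f g); [exact: strip_avoids|exact: plant_strip].
Qed.

Lemma row_rate_le (i : 'I_n) :
  \sum_j edge_rate gamma (upair i j) <= 2 * gamma.
Proof.
have n0 : 0 < n%:R :> R by rewrite ltr0n; case: (n) i => // -[].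
apply: (@le_trans _ _ (\sum_(j < n) 2 * gamma / n%:R)).
  apply: ler_sum => j _; rewrite /edge_rate; case: ifP => // _.
  rewrite ler_wpM2r ?invr_ge0 ?(ltW n0)//.
  by rewrite ler_peMl// ler1n.
rewrite sumr_const card_ord -[_ *+ n]mulr_natl mulrCA divff ?mulr1//.
by rewrite gt_eqF.
Qed.

(** Union bound on the rates: each vertex meets edges at total rate at most
2 gamma. *)
Lemma avoid_mass_ge f : injective f ->
  \prod_(v | (d v < l)%N) expR (- (2 * gamma)) <=
  \prod_(ij | touches f ij) expR (- edge_rate gamma ij).
Proof.
move=> fI; rewrite -!expR_sum ler_expR !sumrN lerN2.
apply: (@le_trans _ _ (\sum_(v | (d v < l)%N) \sum_j edge_rate gamma (upair (f v) j)));
  last by apply: ler_sum => v _; exact: row_rate_le.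
rewrite pair_big_dep/= (partition_big (fun vj => upair (f vj.1) vj.2) (touches f))/=.
  apply: ler_sum => ij /touchesP[v [j [dv E]]].
  rewrite (bigD1 (v, j)) /=; last by rewrite dv E eqxx.
  rewrite -E lerDl sumr_ge0// => vj _; exact: edge_rate_ge0.
by move=> [v j] /andP[dv _]; apply/touchesP; exists v, j.
Qed.

Lemma embeds_mass_ge f : injective f ->
  ((edges_factor * \prod_(v | (d v < l)%N) expR (- (2 * gamma)))%:E <=
   \esum_(g in [set g | embeds None g f]) (poisson_graph_pmf gamma p g)%:E)%E.
Proof.
move=> fI; rewrite esum_embeds//.
rewrite (eq_esum (b := fun h => (edges_factor * poisson_graph_pmf gamma p h)%:E)); last first.
  by move=> h /= hv; rewrite graph_pmf_plant.
rewrite esum_setE.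
under eq_esum do rewrite -mulrA EFinM.
rewrite esumZl ?edges_factor_ge0//; last first.
  by move=> h; rewrite lee_fin mulr_ge0// graph_pmf_ge0.
have := graph_pmf_avoid gamma_ge0 p_ge0 p_sum1 (touches f) => H.
rewrite (eq_esum (b := fun h => (poisson_graph_pmf gamma p h *
   [forall (ij | touches f ij), h ij == [::]]%:R)%:E)); last first.
  by move=> h _; rewrite asboolb.
rewrite H -EFinM lee_fin ler_wpM2l ?edges_factor_ge0//.
exact: avoid_mass_ge.
Qed.

Lemma embeds_sum_le f (u : edge_marks C n -> R) : injective f ->
  (forall h, 0 <= u h) ->
  (\esum_(g in [set g | embeds None g f])
      (poisson_graph_pmf gamma p g * u (strip f g))%:E <=
   edges_factor%:E *
     \esum_(h in setT) (poisson_graph_pmf gamma p h * u h)%:E)%E.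
Proof.
move=> fI u0; rewrite esum_embeds// -esumZl ?edges_factor_ge0//; last first.
  by move=> h; rewrite lee_fin mulr_ge0// graph_pmf_ge0.
rewrite esum_mkcond; apply: le_esum => h _.
case: ifPn; rewrite (inE, notin_setE)/= => hv.
  by rewrite strip_plant// graph_pmf_plant// -EFinM mulrA.
by rewrite mule_ge0 ?lee_fin ?edges_factor_ge0// mulr_ge0 ?graph_pmf_ge0.
Qed.

End Planting.

(** * Labelled trees explored from the root *)

Section Exploration.
Variables (C : finType) (n : nat).

(** Plane marked trees whose vertices carry labels in the multigraph.  Unlike the
pairs of a plane tree and a labelling of its vertices, they form a single
countable type, on which the exploration of the multigraph is a recursion. *)
Fixpoint ltree (l : nat) : countType :=
  if l is l'.+1 then ('I_n * seq (C * ltree l'))%type : countType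
  else 'I_n : countType.

Definition lroot (l : nat) : ltree l -> 'I_n :=
  if l is l'.+1 return ltree l -> 'I_n then fst else id.

Fixpoint shape (l : nat) : ltree l -> gwtree C l :=
  match l return ltree l -> gwtree C l with
  | 0 => fun _ => tt
  | l'.+1 => fun s => [seq (c.1, shape c.2) | c <- s.2]
  end.

Definition in_child (l : nat) (t : gwtree C l.+1) (i : 'I_(size t))
    (v : vert (gwgraph (tnth (in_tuple t) i).2)) : vert (gwgraph t) :=
  Some (Tagged (fun j => vert (gwgraph (tnth (in_tuple t) j).2)) v).

Lemma in_child_inj l (t : gwtree C l.+1) i : injective (@in_child l t i).
Proof. by move=> u v [] /eqP; rewrite eq_Tagged => /eqP. Qed.

Fixpoint labelled (l : nat) :
    forall t : gwtree C l, (vert (gwgraph t) -> 'I_n) -> ltree l :=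
  match l return forall t : gwtree C l, (vert (gwgraph t) -> 'I_n) -> ltree l with
  | 0 => fun _ f => f tt
  | l'.+1 => fun t f => (f None,
      [seq ((tnth (in_tuple t) i).1,
            labelled (fun v => f (@in_child l' t i v)))
         | i <- enum 'I_(size t)])
  end.

Lemma shape_labelled l (t : gwtree C l) f : shape (@labelled l t f) = t.
Proof.
elim: l t f => [|l IH] t f; first by case: t f.
rewrite /= -map_comp -[RHS](map_tnth_enum (in_tuple t)).
by apply: eq_map => i /=; rewrite IH -surjective_pairing.
Qed.

Lemma lroot_labelled l (t : gwtree C l) f :
  lroot (@labelled l t f) = f (groot (gwgraph t)).
Proof. by case: l t f. Qed.

Lemma labelled_inj l (t : gwtree C l) f f' :
  @labelled l t f = @labelled l t f' -> f =1 f'.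
Proof.
elim: l t f f' => [|l IH] t f f' /=; first by move=> E [].
case=> E0 E [[i v]|//].
move/eq_in_map: E => /(_ i); rewrite mem_enum => /(_ isT)[] /IH.
by move/(_ v).
Qed.

Variable g : edge_marks C n.

Definition nbrs (i : 'I_n) (par : option 'I_n) : seq 'I_n :=
  [seq j <- enum 'I_n | (g (upair i j) != [::]) && (par != Some j)].

Fixpoint explored (l : nat) (par : option 'I_n) : ltree l -> bool :=
  match l return ltree l -> bool with
  | 0 => fun _ => true
  | l'.+1 => fun s =>
      perm_eq [seq lroot c.2 | c <- s.2] (nbrs s.1 par) &&
      all (fun c => (g (upair s.1 (lroot c.2)) == [:: c.1]) &&
                    explored (Some s.1) c.2) s.2
  end.

Section Adjacency.
Variables (l : nat) (t : gwtree C l.+1).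
Local Notation sub i := (gwgraph (tnth (in_tuple t) i).2).

Lemma in_child_tag i j (u : vert (sub i)) (v : vert (sub j)) :
  in_child u = in_child v -> i = j.
Proof. by case. Qed.

Lemma adj_groot v : adj (groot (gwgraph t)) v ->
  exists i, v = @in_child l t i (groot (sub i)).
Proof.
move=> /adjP[e /flattenP[s /mapP[i _ ->]]].
rewrite inE => /orP[/eqP -> /= [] // [] <-|]; first by exists i.
by move=> /mapP[e' _ ->] /= [] [].
Qed.

Lemma adj_in_child i (v : vert (sub i)) u : adj (in_child v) u ->
  (u = groot (gwgraph t) /\ v = groot (sub i)) \/
  exists2 w, u = in_child w & adj v w.
Proof.
move=> /adjP[e /flattenP[s /mapP[j _ ->]]].
rewrite inE => /orP[/eqP -> /=|/mapP[f fG -> /=]].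
  case=> H; have E1 := congr1 fst H; have E2 := congr1 snd H => //.
  left; split; first exact: esym E1.
  have ji : j = i := @in_child_tag j i _ _ E2.
  by subst j; have := @in_child_inj l t i _ _ E2.
move=> H; right.
have ji : j = i.
  by case: H => H; [exact: in_child_tag (congr1 fst H)|
    exact: in_child_tag (congr1 snd H)].
subst j; case: H => H; have E1 := congr1 fst H; have E2 := congr1 snd H.
  have E := @in_child_inj l t i _ _ E1; exists f.1.2; first exact: esym E2.
  by apply/adjP; exists f => //; left; rewrite -E; case: (f.1).
have E := @in_child_inj l t i _ _ E2; exists f.1.1; first exact: esym E1.
by apply/adjP; exists f => //; right; rewrite -E; case: (f.1).
Qed.

Lemma edge_to_child i :
  (groot (gwgraph t), @in_child l t i (groot (sub i)), (tnth (in_tuple t) i).1)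
    \in edges (gwgraph t).
Proof.
apply/flattenP; eexists; first by apply: map_f; exact: mem_enum.
exact: mem_head.
Qed.

Lemma edge_in_child i e : e \in edges (sub i) ->
  (@in_child l t i e.1.1, @in_child l t i e.1.2, e.2) \in edges (gwgraph t).
Proof.
move=> eG; apply/flattenP; eexists; first by apply: (map_f _ (x := i)); exact: mem_enum.
by rewrite inE; apply/orP; right; apply/mapP; exists e.
Qed.

End Adjacency.

Lemma embeds_explored l (t : gwtree C l) par (f : {ffun vert (gwgraph t) -> 'I_n}) :
  embeds l (@gwdepth C l t) par g f -> explored par (labelled f).
Proof.
elim: l t par f => [//|l IH] t par f [fI fp fE fN].
set i0 := f None.
have sE i : g (upair i0 (f (@in_child l t i (groot (gwgraph (tnth (in_tuple t) i).2))))) =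
     [:: (tnth (in_tuple t) i).1] by have := fE _ (@edge_to_child l t i).
have labE i : lroot (labelled (fun v => f (@in_child l t i v))) =
  f (@in_child l t i (groot (gwgraph (tnth (in_tuple t) i).2))).
  by rewrite lroot_labelled.
apply/andP; split => /=.
  rewrite -map_comp; apply: uniq_perm.
  - rewrite map_inj_uniq ?enum_uniq// => i j /=; rewrite !labE => /fI.
    exact: in_child_tag.
  - by rewrite filter_uniq ?enum_uniq.
  - move=> j; rewrite mem_filter mem_enum andbT.
    apply/mapP/andP => [[i _ ->]|[gj pj]] /=.
      rewrite labE sE; split=> //; apply/eqP; exact: fp.
    have [[u ju /adj_groot[i ui]]|[_ pj']] := fN None j isT gj.
    - by exists i; rewrite ?mem_enum//= labE -ui.
    - by rewrite pj' eqxx in pj.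
apply/allP => c /mapP[i _ ->] /=; rewrite labE sE eqxx/=.
have := IH (tnth (in_tuple t) i).2 (Some i0) [ffun v => f (@in_child l t i v)].
rewrite (_ : labelled [ffun v => f (@in_child l t i v)] =
  labelled (fun v => f (@in_child l t i v))); last first.
  by congr labelled; apply/funext => v; rewrite ffunE.
apply; split.
- by move=> u v; rewrite !ffunE => /fI /in_child_inj.
- by move=> v; rewrite ffunE => -[/fI].
- move=> e eG; rewrite /edge_pair !ffunE.
  by have := fE _ (@edge_in_child l t i e eG).
- move=> v j dv; rewrite ffunE => gj.
  have [|[u ju /adj_in_child[[ur vr]|[w uw vw]]]|[//]] := fN (in_child v) j _ gj.
  + exact: dv.
  + by right; split => //; rewrite ju ur.
  + by left; exists w => //; rewrite ffunE ju uw.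
Qed.

End Exploration.

(** * Multiplicity of the plantings *)

Section Multiplicity.
Variables (R : realType) (C : finType) (n : nat) (g : edge_marks C n).

Definition share (l : nat) (s : ltree C n l) : R := (orderings (shape s))%:R^-1.

Lemma share_ge0 l (s : ltree C n l) : 0 <= share s.
Proof. by rewrite invr_ge0. Qed.

(** At each vertex the children form one of the k! orderings of its k neighbours,
and the share of the tree is 1 / k! times the product of the shares of the
subtrees, which are bounded inductively. *)
Lemma explored_share_le1 l par i :
  (\esum_(s in [set: ltree C n l])
     (share s * (explored g par s && (lroot s == i))%:R)%:E <= 1)%E.
Proof.
elim: l par i => [|l IH] par i.
  rewrite (@esum_finType _ 'I_n) /=; last by move=> s; rewrite lee_fin mulr_ge0 ?share_ge0.
  rewrite sumEFin lee_fin (bigD1 i)//= eqxx mulr1 big1 ?addr0 /share /= ?invr1//.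
  by move=> j /negbTE ->; rewrite mulr0.
pose N := nbrs g i par.
pose f (j : 'I_n) (c : C * ltree C n l) : R :=
  share c.2 * ((g (upair i j) == [:: c.1]) &&
               (explored g (Some i) c.2 && (lroot c.2 == j)))%:R.
have f0 j c : 0 <= f j c by rewrite /f mulr_ge0 ?share_ge0.
have f1 j : (\esum_(c in setT) (f j c)%:E <= 1)%E.
  rewrite esum_pair; last by move=> c; rewrite lee_fin.
  rewrite esum_finType; last by move=> a; apply: esum_ge0 => s _; rewrite lee_fin.
  apply: le_trans (IH (Some i) j).
  case: (pselect (exists a, g (upair i j) = [:: a])) => [[a ga]|ng].
    rewrite (bigD1 a)//= big1 ?adde0.
      by apply: le_esum => s _; rewrite /f ga eqxx.
    move=> b ba; rewrite esum1// => s _.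
    rewrite /f ga /= eqseq_cons andbT eq_sym (negbTE ba) /= mulr0//.
  rewrite big1; first by apply: esum_ge0 => s _; rewrite lee_fin mulr_ge0 ?share_ge0.
  move=> b _; rewrite esum1// => s _; rewrite /f /=.
  by case: eqP => [gb|_]; [case: ng; exists b|rewrite mulr0].
pose F j := fine (\esum_(c in setT) (f j c)%:E)%E.
have fF j : (\esum_(c in setT) (f j c)%:E = (F j)%:E)%E.
  rewrite /F fineK// ge0_fin_numE; last by apply: esum_ge0 => c _; rewrite lee_fin.
  by rewrite (le_lt_trans (f1 j))// ltry.
have F01 j : 0 <= F j <= 1.
  by rewrite -!lee_fin -fF f1 andbT; apply: esum_ge0 => c _; rewrite lee_fin.
have uN : uniq N by rewrite filter_uniq ?enum_uniq.
(* A list of children is charged to the ordering [pi] of its labels. *)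
pose T (pi : seq 'I_n) (cs : seq (C * ltree C n l)) : \bar R :=
  if cs \in [set cs | size cs = size pi] then
    (\prod_(z <- zip pi cs) f z.1 z.2)%:E else 0%E.
have T0 pi cs : (0 <= T pi cs)%E.
  by rewrite /T; case: ifP => // _; rewrite lee_fin prodr_ge0.
have T1 pi : (\esum_(cs in setT) T pi cs <= 1)%E.
  rewrite -esum_mkcond (esum_seq_prod _ f0 fF) lee_fin.
  by apply: prodr_ile1 => j _.
apply: (@le_trans _ _ (\esum_(cs in [set: seq (C * ltree C n l)])
   ((size N)`!%:R^-1%:E * \sum_(pi <- permutations N) T pi cs))%E).
  rewrite (@esum_pair _ 'I_n (seq (C * ltree C n l))); last first.
    by move=> s; rewrite lee_fin mulr_ge0 ?share_ge0.
  rewrite (@esum_finType _ 'I_n); last first.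
    by move=> s; apply: esum_ge0 => cs _; rewrite lee_fin mulr_ge0 ?share_ge0.
  rewrite (bigD1 i)//= [X in (_ + X)%E]big1 ?adde0; last first.
    by move=> j /negbTE ji; rewrite esum1// => cs _; rewrite ji andbF mulr0.
  apply: le_esum => cs _; rewrite /= eqxx andbT.
  case: (boolP (perm_eq _ _ && all _ _)) => [/andP[pN acs]|_]; last first.
    by rewrite mulr0 mule_ge0 ?lee_fin ?invr_ge0// sume_ge0.
  rewrite mulr1.
  have pin : [seq lroot c.2 | c <- cs] \in permutations N by rewrite mem_permutations.
  rewrite (bigD1_seq _ pin) ?permutations_uniq//=.
  rewrite -[leLHS]adde0.
  rewrite (_ : (share _)%:E = ((size N)`!%:R^-1%:E * T [seq lroot c.2 | c <- cs] cs)%E).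
    rewrite ge0_muleDr ?T0 ?sume_ge0// leeD2l//.
    by apply: mule_ge0; [rewrite lee_fin invr_ge0|apply: sume_ge0 => pi _; exact: T0].
  rewrite /T size_map; case: ifPn => [_|]; last by rewrite notin_setE => /(_ erefl).
  rewrite -EFinM; congr (_%:E).
  rewrite /share /= natrM invfM size_map -(perm_size pN) size_map; congr (_ * _).
  rewrite big_map natr_prod -prodfV.
  rewrite (_ : zip _ cs = [seq (lroot c.2, c) | c <- cs]); last first.
    by elim: (cs) => //= c s ->.
  rewrite big_map [LHS]big_seq [RHS]big_seq; apply: eq_bigr => c ccs.
  by rewrite /f /=; move/allP: acs => /(_ c ccs)/andP[-> ->]; rewrite eqxx mulr1.
rewrite esumZl ?invr_ge0//; last by move=> cs; rewrite sume_ge0.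
rewrite esum_sum//.
have k0 : 0 < (size N)`!%:R :> R by rewrite ltr0n fact_gt0.
rewrite [leRHS](_ : 1%E = ((size N)`!%:R^-1%:E * (size N)`!%:R%:E)%E); last first.
  by rewrite -EFinM mulVf ?gt_eqF.
apply: lee_wpmul2l; first by rewrite lee_fin invr_ge0 ltW.
apply: (@le_trans _ _ (\sum_(pi <- permutations N) 1%E)%E).
  by apply: lee_sum => pi _.
by rewrite sumEFin big_const_seq count_predT size_permutations// iter_addr_0.
Qed.

Local Notation emb l t f := (embeds l (@gwdepth C l t) None g f).

(** Distinct pairs of a tree and a labelling give distinct labelled trees, all of
them explored from the root. *)
Lemma sum_share_embeddings l (S : seq (gwtree C l)) (o : 'I_n) : uniq S ->
  \sum_(t <- S) \sum_(f : {ffun vert (gwgraph t) -> 'I_n})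
     (orderings t)%:R^-1 *
     (`[< emb l t f /\ f (groot (gwgraph t)) = o >])%:R <= 1 :> R.
Proof.
move=> uS.
pose P t (f : {ffun vert (gwgraph t) -> 'I_n}) :=
  `[< emb l t f /\ f (groot (gwgraph t)) = o >].
pose E t := [seq f <- index_enum {ffun vert (gwgraph t) -> 'I_n} | P t f].
pose L := [seq labelled f | t <- S, f : {ffun vert (gwgraph t) -> 'I_n} <- E t].
have uL : uniq L.
  apply: allpairs_uniq_dep => //.
    by move=> t _; rewrite filter_uniq ?index_enum_uniq.
  move=> [t f] [t' f'] _ _ /= H.
  have tt' : t = t' by rewrite -(shape_labelled f) H shape_labelled.
  subst t'; congr (Tagged _ _); apply/ffunP; exact: labelled_inj H.
have LP s : s \in L -> explored g None s && (lroot s == o).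
  move=> /allpairsPdep[t [f [_ + ->]]]; rewrite mem_filter => /andP[/asboolP[H1 H2] _].
  by rewrite embeds_explored// lroot_labelled H2 eqxx.
rewrite -lee_fin; apply: le_trans (explored_share_le1 l None o).
apply: le_trans (sum_le_esum _ uL).
rewrite big_allpairs_dep /= -sumEFin; apply: lee_sum => t _.
rewrite big_filter -sumEFin [leRHS]big_mkcond /=; apply: lee_sum => f _.
case: ifPn => Pf; last first.
  by rewrite -/(P t f) (negbTE Pf) mulr0.
rewrite lee_fin -/(P t f) Pf mulr1 /share shape_labelled.
move/asboolP: Pf => [H1 H2].
by rewrite embeds_explored// lroot_labelled H2 eqxx mulr1.
Qed.

End Multiplicity.

(** * Reconstruction in a planted ball *)

Section FiniteLawFacts.
Variable R : realType.

Lemma law_of_comp (S T U : finType) (q : S -> R) (f : S -> T) (h : T -> U) u :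
  law_of (law_of q f) h u = law_of q (fun x => h (f x)) u.
Proof.
rewrite /law_of [RHS](partition_big f (fun z => h z == u))//=.
apply: eq_bigr => z /eqP hz; apply: eq_bigl => x.
by case: eqP => [->|]; rewrite ?andbF// hz eqxx.
Qed.

Lemma law_of_sum (S T : finType) (q : S -> R) (f : S -> T) :
  \sum_z law_of q f z = \sum_x q x.
Proof. by rewrite [RHS](partition_big f xpredT). Qed.

Lemma law_of_ge0 (S T : finType) (q : S -> R) (f : S -> T) z :
  (forall x, 0 <= q x) -> 0 <= law_of q f z.
Proof. by move=> q0; apply: sumr_ge0. Qed.

Lemma law_of_pair_snd (S A Z : finType) (q : S -> R) (a : S -> A) (z : S -> Z) j :
  law_of q z j = \sum_i law_of q (fun x => (a x, z x)) (i, j).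
Proof.
rewrite /law_of (partition_big a xpredT)//=; apply: eq_bigr => i _.
by apply: eq_bigl => x; rewrite andbC.
Qed.

Definition dependence (S A Z : finType) (q : S -> R) (a : S -> A) (z : S -> Z) : R :=
  tv_dist (law_of q (fun x => (a x, z x)))
          (fun w => law_of q a w.1 * law_of q z w.2).

Lemma eq_dependence (S A Z : finType) (q : S -> R) (a : S -> A) (z z' : S -> Z) :
  z =1 z' -> dependence q a z = dependence q a z'.
Proof. by move/funext ->. Qed.

Lemma dependence_law (S T A Z : finType) (q : S -> R) (f : S -> T)
    (a : T -> A) (z : T -> Z) :
  dependence (law_of q f) a z = dependence q (a \o f) (z \o f).
Proof.
congr (_ * _); apply: eq_bigr => w _.
by rewrite !law_of_comp.
Qed.

(** The factorization says that, given the value of [pi], the observation [z]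
carries no information on [a]; discarding the rest of [z] therefore loses
nothing. *)
Lemma dependence_sufficient (S A Z F : finType) (q : S -> R)
    (a : S -> A) (z : S -> Z) (pi : Z -> F) (K : Z -> R) (w : A -> F -> R) :
  (forall j, 0 <= K j) ->
  (forall i j, law_of q (fun x => (a x, z x)) (i, j) = K j * w i (pi j)) ->
  dependence q a z = dependence q a (pi \o z).
Proof.
move=> K0 H; congr (_ * _).
pose w' k := \sum_i w i k.
have Hz j : law_of q z j = K j * w' (pi j).
  by rewrite (law_of_pair_snd _ a) mulr_sumr; apply: eq_bigr => i _; rewrite H.
have Hf i k : law_of q (fun x => (a x, (pi \o z) x)) (i, k) =
    (\sum_(j | pi j == k) K j) * w i k.
  have := @law_of_comp S (A * Z)%type (A * F)%type q (fun x => (a x, z x))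
    (fun m => (m.1, pi m.2)) (i, k).
  rewrite /= => <-.
  rewrite {1}/law_of mulr_suml.
  rewrite (eq_bigl (fun m : A * Z => (m.1 == i) && (pi m.2 == k))); last first.
    by move=> m; rewrite xpair_eqE.
  rewrite -(pair_big (fun m => m == i) (fun j => pi j == k)
     (fun m j => law_of q (fun x => (a x, z x)) (m, j)))/= big_pred1_eq.
  by apply: eq_bigr => j /eqP <-.
have Hfz k : law_of q (pi \o z) k = (\sum_(j | pi j == k) K j) * w' k.
  by rewrite (law_of_pair_snd _ a) mulr_sumr; apply: eq_bigr => i _; rewrite Hf.
rewrite -(pair_bigA _ (fun i j => `|law_of q (fun x => (a x, z x)) (i, j) -
   law_of q a i * law_of q z j|))/=.
rewrite -(pair_bigA _ (fun i j => `|law_of q (fun x => (a x, (pi \o z) x)) (i, j) -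
   law_of q a i * law_of q (pi \o z) j|))/=.
apply: eq_bigr => i _; rewrite (partition_big pi xpredT)//=.
apply: eq_bigr => k _; rewrite Hf Hfz mulrCA -mulrBr normrM ger0_norm ?sumr_ge0//.
rewrite mulr_suml; apply: eq_bigr => j /eqP jk.
by rewrite H Hz jk mulrCA -mulrBr normrM ger0_norm.
Qed.

Lemma law_of_contract (S T : finType) (q q' : S -> R) (f : S -> T) :
  \sum_z `|law_of q f z - law_of q' f z| <= \sum_x `|q x - q' x|.
Proof.
rewrite [leRHS](partition_big f xpredT)//=; apply: ler_sum => z _.
by rewrite -sumrB; exact: ler_norm_sum.
Qed.

Lemma tv_dist_lip (T : finType) (a b a' b' : T -> R) :
  tv_dist a b <= tv_dist a' b' +
    2^-1 * (\sum_z `|a z - a' z| + \sum_z `|b z - b' z|).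
Proof.
rewrite /tv_dist -mulrDr ler_wpM2l ?invr_ge0// -!big_split/=.
apply: ler_sum => z _.
rewrite (_ : a z - b z = (a' z - b' z) + ((a z - a' z) - (b z - b' z))); last by ring.
by apply: le_trans (ler_normD _ _) _; rewrite lerD2l ler_normB.
Qed.

Lemma dependence_lip (S A Z : finType) (q q' : S -> R) (a : S -> A) (z : S -> Z) :
  (forall x, 0 <= q x) -> (forall x, 0 <= q' x) ->
  \sum_x q x = 1 -> \sum_x q' x = 1 ->
  dependence q a z <= dependence q' a z + 3 / 2 * \sum_x `|q x - q' x|.
Proof.
move=> q0 q'0 q1 q'1; set D := \sum_x _.
apply: le_trans (tv_dist_lip _ _ (law_of q' (fun x => (a x, z x)))
  (fun w => law_of q' a w.1 * law_of q' z w.2)) _.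
rewrite -/(dependence q' a z) lerD2l.
set E1 := \sum_z0 `|law_of q (fun x => (a x, z x)) _ - _|; set E2 := \sum_z0 _.
have h1 : E1 <= D by exact: law_of_contract.
suff h2 : E2 <= D + D by lra.
rewrite /E2.
apply: (@le_trans _ _ (\sum_(w : A * Z) (`|law_of q a w.1 - law_of q' a w.1| * law_of q z w.2 +
    law_of q' a w.1 * `|law_of q z w.2 - law_of q' z w.2|))).
  apply: ler_sum => w _.
  set u := law_of q a _; set v := law_of q z _; set u' := law_of q' a _; set v' := law_of q' z _.
  rewrite (_ : u * v - u' * v' = (u - u') * v + u' * (v - v')); last by ring.
  apply: le_trans (ler_normD _ _) _; rewrite !normrM.
  by rewrite (ger0_norm (law_of_ge0 _ _ q0)) (ger0_norm (law_of_ge0 _ _ q'0)).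
rewrite big_split/= lerD//.
  rewrite -(pair_bigA _ (fun i j => `|law_of q a i - law_of q' a i| * law_of q z j))/=.
  under eq_bigr do rewrite -mulr_sumr law_of_sum q1 mulr1.
  exact: law_of_contract.
rewrite -(pair_bigA _ (fun i j => law_of q' a i * `|law_of q z j - law_of q' z j|))/=.
under eq_bigr do rewrite -mulr_sumr.
by rewrite -mulr_suml law_of_sum q'1 mul1r law_of_contract.
Qed.

(** With A and B the two normalizations, both u - 1 and A / B - 1 are of size at
most [e], and A is at least B / 2. *)
Lemma reweighted_l1 (T : finType) (u W : T -> R) (e : R) :
  0 <= e <= 1 / 2 -> (forall y, 0 <= W y) -> 0 < \sum_y W y ->
  (forall y, `|u y - 1| <= e) ->
  \sum_y `|u y * W y / (\sum_z u z * W z) - W y / (\sum_z W z)| <= 4 * e.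
Proof.
move=> /andP[e0 e1] W0; set B := \sum_y W y => B0 ue.
set A := \sum_z u z * W z.
have AB : `|A - B| <= e * B.
  rewrite /A /B -sumrB mulr_sumr; apply: le_trans (ler_norm_sum _ _ _) _.
  apply: ler_sum => y _; rewrite -{2}[W y]mul1r -mulrBl normrM (ger0_norm (W0 y)).
  by rewrite ler_wpM2r.
have eB : e * B <= 1 / 2 * B by rewrite ler_wpM2r ?(ltW B0).
have A0 : B / 2 <= A by move: AB; rewrite ler_norml => /andP[? ?]; lra.
have Ap : 0 < A by apply: lt_le_trans A0; rewrite divr_gt0.
apply: (@le_trans _ _ (\sum_y (2 * e / A) * W y)).
  apply: ler_sum => y _.
  rewrite (_ : _ - _ = ((u y - 1) * B + (B - A)) * W y / (A * B)); last first.
    by field; rewrite !gt_eqF.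
  rewrite normrM normfV [X in _ / X]ger0_norm ?mulr_ge0 ?(ltW Ap) ?(ltW B0)//.
  rewrite normrM (ger0_norm (W0 y)) ler_pdivrMr ?mulr_gt0//.
  rewrite (_ : 2 * e / A * W y * (A * B) = 2 * e * B * W y); last first.
    by field; rewrite gt_eqF.
  rewrite ler_wpM2r//; apply: le_trans (ler_normD _ _) _.
  rewrite normrM (ger0_norm (ltW B0)) (distrC B A).
  have : `|u y - 1| * B <= e * B by rewrite ler_wpM2r ?(ltW B0).
  by move: AB; lra.
rewrite -mulr_sumr -/B mulrAC ler_pdivrMr//.
have : e * (B / 2) <= e * A by rewrite ler_wpM2l.
lra.
Qed.

End FiniteLawFacts.

Section GraphVersusTree.
Variables (R : realType) (X C : finType) (psi : C -> X -> X -> R).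
Hypotheses (psi_ge0 : forall a x y, 0 <= psi a x y)
  (psi_sym : forall a x y, psi a x y = psi a y x).

Lemma weight_ge0 (G : mgraph C) (x : {ffun vert G -> X}) : 0 <= weight psi x.
Proof. by rewrite prodr_ge0. Qed.

Lemma partition_fun_ge0 (G : mgraph C) : 0 <= partition_fun psi G.
Proof. by rewrite sumr_ge0// => x _; exact: weight_ge0. Qed.

Lemma canonical_measure_ge0 (G : mgraph C) (x : {ffun vert G -> X}) :
  0 <= canonical_measure psi x.
Proof. by rewrite divr_ge0 ?weight_ge0 ?partition_fun_ge0. Qed.

Lemma canonical_measure_sum1 (G : mgraph C) : 0 < partition_fun psi G ->
  \sum_(x : {ffun vert G -> X}) canonical_measure psi x = 1.
Proof. by move=> Z0; rewrite -mulr_suml divff// gt_eqF. Qed.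

Lemma weight_mgraph_of n (g : edge_marks C n) (x : {ffun 'I_n -> X}) :
  weight psi (G := mgraph_of g) x =
  \prod_ij \prod_(a <- g ij) psi a (x (val ij).1) (x (val ij).2).
Proof.
rewrite /weight big_flatten /= big_map big_enum /=.
by apply: eq_bigr => ij _; rewrite big_map.
Qed.

Lemma adj_mgraph_of n (g : edge_marks C n) (i j : 'I_n) :
  adj (G := mgraph_of g) i j = (g (upair i j) != [::]).
Proof.
apply/hasP/idP => [[e /flattenP[s /mapP[ij _ ->] /mapP[a ag ->]]] /=|].
  move=> E; suff <- : ij = upair i j by case: (g ij) ag.
  have {E} [E|E] : val ij = (i, j) \/ val ij = (j, i).
    by case/orP: E => /eqP E; [left|right].
  - by rewrite (upairE ij) E.
  - by rewrite (upairE ij) E upairC.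
case E: (g (upair i j)) => [//|a s] _.
exists (val (upair i j), a).
  apply/flattenP; eexists; first by apply: map_f; exact: mem_enum.
  by apply/mapP; exists a => //; rewrite E mem_head.
by rewrite val_upair; case: ifP => _; rewrite eqxx ?orbT.
Qed.

Variables (n l t : nat) (G : rgraph C) (d : vert G -> nat).
Hypotheses (dP : is_depth l d) (tl : (t <= l)%N).
Variables (g : edge_marks C n) (f : {ffun vert G -> 'I_n}).
Hypothesis gf : embeds l d None g f.

Let h := strip l d f g.
Let GN : rgraph C := @RGraph C (mgraph_of g) (f (groot G)).

Definition pull (x : {ffun 'I_n -> X}) : {ffun vert G -> X} := [ffun v => x (f v)].

Lemma emb_inj : injective f. Proof. by case: gf. Qed.

Lemma weight_plant (x : {ffun 'I_n -> X}) :
  weight psi (G := mgraph_of g) x =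
  weight psi (G := mgraph_of h) x * weight psi (pull x).
Proof.
rewrite -(plant_strip dP gf) !weight_mgraph_of mulrC.
have -> : weight psi (pull x) = \prod_ij \prod_(a <- planted f ij)
    psi a (x (val ij).1) (x (val ij).2).
  rewrite /weight; under [RHS]eq_bigr do rewrite big_map big_filter.
  rewrite (exchange_big_dep xpredT)//=; apply: eq_bigr => e _.
  rewrite (big_pred1 (edge_pair f e)) // !ffunE /edge_pair val_upair.
  by case: ifP => // _; exact: psi_sym.
by rewrite -big_split/=; apply: eq_bigr => ij _; rewrite ffunE big_cat.
Qed.

Lemma adj_embed u v : adj u v -> adj (G := mgraph_of g) (f u) (f v).
Proof.
case: gf => _ _ gE _ /adjP[e eG E]; rewrite adj_mgraph_of.
have := gE e eG; rewrite /edge_pair.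
by case: E => -> /= E'; rewrite ?E'// upairC E'.
Qed.

(** A walk that is short enough only leaves vertices of depth less than [l], at
which every edge of the multigraph is an edge of the tree. *)
Lemma path_lift w u : (d u + size w <= l)%N ->
  path (@adj C (mgraph_of g)) (f u) w ->
  exists2 v, last (f u) w = f v & (d v <= d u + size w)%N.
Proof.
elim: w u => [|j w IH] u /=; first by rewrite addn0; exists u.
rewrite -[(size w).+1]add1n addnA addn1 => dl.
rewrite adj_mgraph_of => /andP[gj pw].
have du : (d u < l)%N by rewrite (leq_trans _ dl)// ltnS leq_addr.
have [_ _ _ gN] := gf; have [[v jv uv]|[//]] := gN u j du gj.
have dv := adj_depth dP uv.
rewrite jv in pw *; have [|k -> dk] := IH v _ pw.
- by rewrite (leq_trans _ dl)// leq_add2r.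
- by exists k => //; rewrite (leq_trans dk)// leq_add2r.
Qed.

Lemma mem_far_embed (i : 'I_n) :
  (i \in far GN t) = ~~ [exists v, (d v < t)%N && (f v == i)].
Proof.
rewrite inE; congr (~~ _); apply/existsP/existsP.
  move=> [k /existsP[w /andP[pw /eqP lw]]].
  have wk := size_tuple w; have kt := ltn_ord k.
  have [d0 _ _ _] := dP.
  have [|v E dv] := path_lift (u := groot G) (w := w) _ pw.
    by rewrite d0 wk (leq_trans (ltnW kt)).
  exists v; rewrite -E lw eqxx andbT (leq_ltn_trans dv)// d0 wk.
  exact: kt.
move=> [v /andP[dv /eqP <-]].
have [w [ws pw lw]] := path_to dP v.
exists (Ordinal dv); apply/existsP.
have hs : size [seq f u | u <- w] == Ordinal dv by rewrite size_map ws.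
exists (Tuple hs); rewrite /= last_map lw eqxx andbT path_map.
by apply: sub_path pw => a b; exact: adj_embed.
Qed.

Variable x0 : X.

Let Z : finType := {ffun {i : 'I_n | i \in far GN t} -> X}.

Let ext (z : Z) : {ffun 'I_n -> X} := [ffun i => oapp z x0 (insub i)].

Let ext_far (x : {ffun 'I_n -> X}) i : i \in far GN t ->
  ext (restr_to (far GN t) x) i = x i.
Proof. by move=> fi; rewrite ffunE insubT /= ffunE. Qed.

Let far_embed v : (f v \in far GN t) = (v \in far G t).
Proof.
rewrite mem_far_embed (mem_far dP) leqNgt; congr (~~ _).
apply/existsP/idP => [[u /andP[du /eqP/emb_inj <-]]//|dv].
by exists v; rewrite dv eqxx.
Qed.

Let W_in (y : {ffun vert G -> X}) : R :=
  \prod_(e <- edges G | (d e.1.1 < t)%N) psi e.2 (y e.1.1) (y e.1.2).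
Let W_out (y : {ffun vert G -> X}) : R :=
  \prod_(e <- edges G | ~~ (d e.1.1 < t)%N) psi e.2 (y e.1.1) (y e.1.2).

Let weight_far (x x' : {ffun 'I_n -> X}) :
  (forall i, i \in far GN t -> x i = x' i) ->
  weight psi (G := mgraph_of h) x = weight psi (G := mgraph_of h) x'.
Proof.
move=> xx'; rewrite !weight_mgraph_of; apply: eq_bigr => ij _.
rewrite ffunE; case: ifPn => [|tij]; first by rewrite !big_nil.
have far_i v j : ij = upair (f v) j -> ~~ (d v < t)%N.
  move=> E; apply: contraNN tij => dv; apply/touchesP.
  by exists v, j; rewrite (leq_trans dv tl).
have f1 : (val ij).1 \in far GN t.
  rewrite mem_far_embed; apply/existsP => -[v /andP[dv /eqP fv]].
  by have := far_i v (val ij).2; rewrite fv -upairE dv => /(_ erefl).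
have f2 : (val ij).2 \in far GN t.
  rewrite mem_far_embed; apply/existsP => -[v /andP[dv /eqP fv]].
  by have := far_i v (val ij).1; rewrite fv upairC -upairE dv => /(_ erefl).
by apply: eq_bigr => a _; rewrite !xx'.
Qed.

Let W_out_far (y y' : {ffun vert G -> X}) :
  (forall v, v \in far G t -> y v = y' v) -> W_out y = W_out y'.
Proof.
move=> yy'; rewrite /W_out big_seq_cond [RHS]big_seq_cond.
apply: eq_bigr => e /andP[eG]; rewrite -leqNgt => te.
have [_ ds _ _] := dP.
by rewrite !yy'// (mem_far dP)// ds// leqW.
Qed.

Let pi (z : Z) := restr_to (far G t) (pull (ext z)).

Let pi_restr x : pi (restr_to (far GN t) x) = restr_to (far G t) (pull x).
Proof.
apply/ffunP => v; rewrite !ffunE -[RHS]ext_far; first by rewrite ffunE.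
by rewrite far_embed; exact: valP.
Qed.

Let glue (z : Z) (y : {ffun vert G -> X}) : {ffun 'I_n -> X} :=
  [ffun i => if [pick v | (d v < t)%N && (f v == i)] is Some v then y v else ext z i].

Let glue_near z y v : (d v < t)%N -> glue z y (f v) = y v.
Proof.
move=> dv; rewrite ffunE; case: pickP => [u /andP[_ /eqP/emb_inj ->]//|/(_ v)].
by rewrite dv eqxx.
Qed.

Let glue_far z y i : i \in far GN t -> glue z y i = ext z i.
Proof.
rewrite mem_far_embed => /existsP fi; rewrite ffunE; case: pickP => // v vi.
by case: fi; exists v.
Qed.

Let restr_glue z y : restr_to (far GN t) (glue z y) = z.
Proof.
apply/ffunP => i; rewrite ffunE glue_far; last exact: valP.
by rewrite ffunE valK.
Qed.

(** Once the far spins are fixed, a configuration amounts to its tree spins: [pull]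
and [glue] are inverse to each other. *)
Let sum_fibre (a : X) (z : Z) :
  \sum_(x : {ffun 'I_n -> X} | (x (f (groot G)) == a) && (restr_to (far GN t) x == z))
     W_in (pull x) =
  \sum_(y : {ffun vert G -> X} | (y (groot G) == a) && (restr_to (far G t) y == pi z))
     W_in y.
Proof.
have pullK y : restr_to (far G t) y = pi z -> pull (glue z y) = y.
  move=> yz; apply/ffunP => v; rewrite ffunE.
  have [dv|] := boolP (d v < t)%N; first exact: glue_near.
  rewrite -leqNgt -(mem_far dP) => vf; rewrite glue_far ?far_embed//.
  have /= := congr1 (fun r : {ffun {v | v \in far G t} -> X} => r (Sub v vf)) yz.
  by rewrite /pi /restr_to !ffunE /= => ->.
rewrite (reindex_onto (glue z) pull) /=.
  apply: eq_big => [y|y /andP[_ /eqP ->]//].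
  rewrite restr_glue eqxx andbT; apply/andP/andP => -[/eqP ya /eqP yz].
    by rewrite -{1 2}yz ffunE ya eqxx -pi_restr restr_glue eqxx.
  by rewrite (pullK y yz) eqxx -{1}(pullK y yz) ffunE in ya *; rewrite ya eqxx.
move=> x /andP[_ /eqP xz]; apply/ffunP => i.
have [fi|] := boolP (i \in far GN t).
  by rewrite glue_far// -xz ext_far.
rewrite mem_far_embed negbK => /existsP[v /andP[dv /eqP <-]].
by rewrite glue_near// ffunE.
Qed.

Definition recon_law (q : {ffun vert G -> X} -> R) : R :=
  dependence q (fun y => y (groot G)) (restr_to (far G t)).

Lemma recon_tv_tree : recon_tv psi G t = recon_law (@canonical_measure R X C psi G).
Proof. by []. Qed.

(** Markov property: the edges between vertices at depth less than [t] and their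
children involve the tree spins only, and every other edge joins two far
vertices.  Hence the joint weight of the root spin and of the far spins is a
function of the far spins times a function of the root spin and of the far spins
of the tree. *)
Lemma recon_tv_pull : recon_tv psi GN t =
  recon_law (law_of (@canonical_measure R X C psi (mgraph_of g)) pull).
Proof.
rewrite /recon_law dependence_law.
rewrite -[LHS]/(dependence (@canonical_measure R X C psi (mgraph_of g))
  (fun x => x (f (groot G))) (restr_to (far GN t))).
pose Zg := partition_fun psi (mgraph_of g).
rewrite (@dependence_sufficient _ _ _ _ _ _ _ _ pi
  (fun z => weight psi (G := mgraph_of h) (ext z) * W_out (pull (ext z)) / Zg)
  (fun a k => \sum_(y : {ffun vert G -> X} |
     (y (groot G) == a) && (restr_to (far G t) y == k)) W_in y)).
- transitivity (dependence (@canonical_measure R X C psi (mgraph_of g))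
    (fun x => x (f (groot G))) (fun x => restr_to (far G t) (pull x))).
    by apply: eq_dependence => x /=; exact: pi_restr.
  by congr dependence; apply/funext => x; rewrite /= /pull ffunE.
- move=> z; rewrite divr_ge0 ?partition_fun_ge0// mulr_ge0 ?weight_ge0// prodr_ge0//.
- move=> a z; rewrite -sum_fibre /law_of mulr_sumr.
  apply: eq_big => [x|x]; rewrite xpair_eqE// => /andP[_ /eqP xz].
  rewrite /canonical_measure weight_plant -/Zg [RHS]mulrAC; congr (_ / _).
  rewrite (_ : weight psi (pull x) = W_in (pull x) * W_out (pull x)); last first.
    by rewrite /weight (bigID (fun e => (d e.1.1 < t)%N)).
  rewrite (@weight_far x (ext z)); last by move=> i fi; rewrite -xz ext_far.
  rewrite (@W_out_far (pull x) (pull (ext z))); first by rewrite mulrA mulrAC.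
  by move=> v vf; rewrite !ffunE -[LHS]ext_far ?far_embed// xz ffunE.
Qed.

Lemma recon_tv_close (e : R) :
  0 <= e <= 1 / 2 ->
  0 < partition_fun psi (mgraph_of g) -> 0 < partition_fun psi (mgraph_of h) ->
  (forall y, `|#|X|%:R ^+ #|vert G| *
     law_of (@canonical_measure R X C psi (mgraph_of h)) pull y - 1| <= e) ->
  `|recon_tv psi GN t - recon_tv psi G t| <= 6 * e.
Proof.
move=> e01 Zg Zh ue.
set muH := law_of _ _ in ue.
set k := #|X|%:R ^+ #|vert G| : R in ue.
have k0 : 0 < k by rewrite exprn_gt0// ltr0n; apply/card_gt0P; exists x0.
pose W (y : {ffun vert G -> X}) := weight psi y.
have W0 y : 0 <= W y by exact: weight_ge0.
have ZgE : partition_fun psi (mgraph_of g) =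
    partition_fun psi (mgraph_of h) * \sum_y muH y * W y.
  rewrite /partition_fun (partition_big pull xpredT)//= mulr_sumr.
  apply: eq_bigr => y _; rewrite /muH /law_of mulrA mulr_sumr mulr_suml.
  apply: eq_bigr => x /eqP <-; rewrite weight_plant /canonical_measure.
  by rewrite [X in _ = X * _]mulrC mulfVK// gt_eqF.
have rhoE y : law_of (@canonical_measure R X C psi (mgraph_of g)) pull y =
    (k * muH y) * W y / (\sum_z (k * muH z) * W z).
  transitivity (muH y * W y / (\sum_z muH z * W z)).
    have A0 : \sum_z muH z * W z != 0.
      by apply: contraTneq Zg => E; rewrite ZgE E mulr0 ltxx.
    rewrite /law_of /canonical_measure ZgE; move: A0; set S := \sum_z _ => A0.
    rewrite /muH /law_of [X in _ = X / _]mulr_suml [RHS]mulr_suml.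
    apply: eq_bigr => x /eqP <-; rewrite weight_plant /canonical_measure -/(W _).
    by field; rewrite A0 gt_eqF.
  under [X in _ = _ / X]eq_bigr do rewrite -mulrA.
  by rewrite -mulr_sumr -(mulrA k) -mulf_div divff ?mul1r// gt_eqF.
have WZ : 0 < \sum_y W y.
  rewrite lt_neqAle sumr_ge0// andbT eq_sym; apply: contraTneq Zg => E.
  rewrite ZgE big1 ?mulr0 ?ltxx// => y _.
  by move: E => /eqP; rewrite psumr_eq0// => /allP/(_ y)
    /(_ (mem_index_enum y))/implyP/(_ isT)/eqP ->; rewrite mulr0.
have D := reweighted_l1 e01 W0 WZ ue.
pose q := law_of (@canonical_measure R X C psi (mgraph_of g)) pull.
pose q' := @canonical_measure R X C psi G.
have q0 y : 0 <= q y by apply: law_of_ge0 => x; exact: canonical_measure_ge0.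
have q1 : \sum_y q y = 1 by rewrite law_of_sum; exact: canonical_measure_sum1.
have q'0 y : 0 <= q' y by exact: canonical_measure_ge0.
have q'1 : \sum_y q' y = 1 by exact: canonical_measure_sum1.
have qq' : \sum_y `|q y - q' y| <= 4 * e.
  by apply: le_trans D; apply: ler_sum => y _; rewrite /q rhoE.
rewrite recon_tv_pull recon_tv_tree -/q -/q' ler_norml.
pose root_spin (y : {ffun vert G -> X}) := y (groot G).
have := dependence_lip root_spin (restr_to (far G t)) q0 q'0 q1 q'1.
have := dependence_lip root_spin (restr_to (far G t)) q'0 q0 q'1 q1.
rewrite -!/(recon_law _).
have -> : \sum_y `|q' y - q y| = \sum_y `|q y - q' y|.
  by apply: eq_bigr => y _; rewrite distrC.
by move=> A B; apply/andP; split; lra.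
Qed.

End GraphVersusTree.

(** * Estimates at a fixed number of vertices *)

Section FixedSize.
Variables (R : realType) (X C : finType) (gamma : R) (psi : C -> X -> X -> R)
  (p : C -> R).
Hypotheses (gamma_ge0 : 0 <= gamma) (psi_ge0 : forall a x y, 0 <= psi a x y)
  (psi_sym : forall a x y, psi a x y = psi a y x)
  (p_ge0 : forall a, 0 <= p a) (p_sum1 : \sum_a p a = 1).
Variable n : nat.
Hypothesis n_gt0 : (0 < n)%N.
Hypothesis well_defined : forall g : edge_marks C n,
  0 < poisson_graph_pmf gamma p g -> 0 < partition_fun psi (mgraph_of g).

Local Notation pmf g := (poisson_graph_pmf gamma p g).
Local Notation mu h := (@canonical_measure R X C psi (mgraph_of h)).
Let pmf_ge0 (g : edge_marks C n) : 0 <= pmf g := graph_pmf_ge0 gamma_ge0 p_ge0 g.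
Let mu_ge0 (g : edge_marks C n) x : 0 <= mu g x := canonical_measure_ge0 psi_ge0 x.

Lemma replica_expectationE (F : {ffun 'I_n -> X} -> {ffun 'I_n -> X} -> R) :
  (forall x1 x2, 0 <= F x1 x2) ->
  replica_expectation gamma p psi F =
  (\esum_(h in [set: edge_marks C n])
     (pmf h * \sum_x1 \sum_x2 mu h x1 * mu h x2 * F x1 x2)%:E)%E.
Proof.
pose X2 : finType := ({ffun 'I_n -> X} * {ffun 'I_n -> X})%type.
move=> F0; rewrite /replica_expectation.
rewrite (@esum_pair _ (edge_marks C n) X2); last first.
  by move=> w; rewrite lee_fin mulr_ge0// mulr_ge0// mulr_ge0.
apply: eq_esum => h _; rewrite (@esum_finType _ X2); last first.
  by move=> w; rewrite lee_fin mulr_ge0// mulr_ge0// mulr_ge0.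
rewrite sumEFin pair_bigA mulr_sumr; congr (_%:E); apply: eq_bigr => w _.
by rewrite -mulrA.
Qed.

Definition total_defect : \bar R :=
  (\sum_(z : X) replica_expectation gamma p psi
     (fun x1 x2 : {ffun 'I_n -> X} => (overlap_defect R z x1 x2 ^+ 2)%R))%E.

Lemma expected_overlap_moment_le :
  (\esum_(h in [set: edge_marks C n])
     (pmf h * \sum_z overlap_moment (mu h) z)%:E <= total_defect)%E.
Proof.
rewrite /total_defect.
have E z := @replica_expectationE (fun x1 x2 => overlap_defect R z x1 x2 ^+ 2)
  (fun _ _ => sqr_ge0 _).
under eq_bigr do rewrite E.
rewrite -esum_sum; last first.
  move=> h z _ _; rewrite lee_fin mulr_ge0// sumr_ge0// => x _.
  by rewrite sumr_ge0// => x' _; rewrite mulr_ge0 ?sqr_ge0// mulr_ge0.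
apply: le_esum => h _; rewrite sumEFin lee_fin -mulr_sumr ler_wpM2l//.
apply: ler_sum => z _; exact: overlap_moment_le_defect.
Qed.

Section OneTree.
Variables (l : nat) (tr : gwtree C l).
Local Notation T := (gwgraph tr).
Local Notation V := (vert T).
Local Notation m := #|V|.
Local Notation emb g f := (embeds l (@gwdepth C l tr) None g f).
Let dP := gwdepthP tr.

Definition root_share (w : edge_marks C n * 'I_n) : R :=
  \sum_(f : {ffun V -> 'I_n})
    (orderings tr)%:R^-1 * (`[< emb w.1 f /\ f (groot T) = w.2 >])%:R.

Lemma root_share_ge0 w : 0 <= root_share w.
Proof. by rewrite sumr_ge0// => f _; rewrite mulr_ge0. Qed.

Lemma esum_root_share (F : edge_marks C n * 'I_n -> R) : (forall w, 0 <= F w) ->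
  (\esum_(w in setT) (pmf w.1 / n%:R * (root_share w * F w))%:E =
   \sum_(f : {ffun V -> 'I_n}) (n%:R^-1 * (orderings tr)%:R^-1)%:E *
     \esum_(g in [set g | emb g f]) (pmf g * F (g, f (groot T)))%:E)%E.
Proof.
move=> F0.
rewrite (@esum_pair _ (edge_marks C n) 'I_n); last first.
  by move=> w; rewrite lee_fin mulr_ge0 ?divr_ge0// mulr_ge0// root_share_ge0.
transitivity (\esum_(g in [set: edge_marks C n]) \sum_(f : {ffun V -> 'I_n})
  ((n%:R^-1 * (orderings tr)%:R^-1) * (pmf g * F (g, f (groot T)) * (`[< emb g f >])%:R))%:E)%E.
  apply: eq_esum => g _; rewrite (@esum_finType _ 'I_n); last first.
    by move=> o; rewrite lee_fin mulr_ge0 ?divr_ge0// mulr_ge0// root_share_ge0.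
  rewrite !sumEFin; congr (_%:E); rewrite /root_share.
  under eq_bigr do rewrite mulr_suml mulr_sumr.
  rewrite exchange_big; apply: eq_bigr => f _.
  rewrite (bigD1 (f (groot T)))//= big1 ?addr0; last first.
    move=> o of'; rewrite asboolF ?mulr0 ?mul0r ?mulr0// => -[_ E].
    by rewrite E eqxx in of'.
  rewrite (_ : `[< emb g f /\ f (groot T) = f (groot T) >] = `[< emb g f >]).
    by ring.
  by apply/asboolP/asboolP => [[]|].
rewrite esum_sum; last first.
  by move=> g f _ _; rewrite lee_fin mulr_ge0 ?mulr_ge0// mulr_ge0.
apply: eq_bigr => f _; rewrite [in RHS]esum_setE -[in RHS]esumZl ?mulr_ge0//.
by move=> g; rewrite lee_fin mulr_ge0// mulr_ge0.
Qed.

Let edge_product : R := \prod_(e <- edges T) (2 * gamma * p e.2).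

Let edge_product_ge0 : 0 <= edge_product.
Proof. by rewrite prodr_ge0// => e _; rewrite !mulr_ge0. Qed.

Let n0 : n%:R != 0 :> R.
Proof. by rewrite pnatr_eq0 -lt0n. Qed.

Lemma edges_factorE : edges_factor n T gamma p = n%:R * edge_product / n%:R ^+ m.
Proof.
rewrite (card_vert_tree dP) exprS invfM mulrACA divff// mul1r.
rewrite /edges_factor /edge_product.
rewrite (eq_bigr (fun e => (2 * gamma * p e.2) * n%:R^-1)); last first.
  by move=> e _; rewrite mulrAC.
by rewrite big_split/= big_const_seq count_predT iter_mulr_1 exprVn.
Qed.

(** Each of the n ^_ m injective labellings contributes the same lower bound, whose
product with n ^ m is the Galton-Watson weight by [gw_pmf_edges]. *)
Lemma root_share_mass_ge :
  ((gw_pmf gamma p tr * (n ^_ m)%:R / n%:R ^+ m)%:E <=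
   \esum_(w in [set: edge_marks C n * 'I_n]) (pmf w.1 / n%:R * root_share w)%:E)%E.
Proof.
rewrite (eq_esum (b := fun w => (pmf w.1 / n%:R * (root_share w * 1))%:E)); last first.
  by move=> w _; rewrite mulr1.
rewrite (esum_root_share (fun _ => ler01)).
pose c := n%:R^-1 * (orderings tr)%:R^-1 : R.
have c0 : 0 <= c by rewrite mulr_ge0.
pose ex := \prod_(v : V | (gwdepth v < l)%N) expR (- (2 * gamma)).
apply: (@le_trans _ _ (\sum_(f : {ffun V -> 'I_n} | injectiveb f)
   (c * (edges_factor n T gamma p * ex))%:E)%E).
  have cinj : #|[pred f : {ffun V -> 'I_n} | injectiveb f]| = (n ^_ m)%N.
    by have := card_inj_ffuns V 'I_n; rewrite card_ord cardsE.
  rewrite sumEFin lee_fin sumr_const cinj edges_factorE.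
  have -> : gw_pmf gamma p tr = edge_product * ex / (orderings tr)%:R.
    by rewrite -gw_pmf_edges mulfK// pnatr_eq0 -lt0n orderings_gt0.
  have alg (E A O N q P : R) : q != 0 -> O != 0 -> P != 0 ->
      E * A / O * N / P = q^-1 * O^-1 * (q * E / P * A) * N.
    by move=> *; field; apply/and3P.
  rewrite -[leRHS]mulr_natr /c le_eqVlt; apply/orP; left; apply/eqP.
  by apply: alg; rewrite ?expf_neq0// pnatr_eq0 -lt0n orderings_gt0.
rewrite big_mkcond; apply: lee_sum => f _; case: ifPn => [/injectiveP fI|_].
  rewrite EFinM lee_wpmul2l ?lee_fin//.
  apply: le_trans (embeds_mass_ge dP gamma_ge0 p_ge0 p_sum1 fI) _.
  by apply: le_esum => g _; rewrite mulr1.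
rewrite mule_ge0 ?lee_fin//; apply: esum_ge0 => g _.
by rewrite lee_fin mulr1.
Qed.

Variable x0 : X.
Let k : R := #|X|%:R.
Let k_gt0 : 0 < k.
Proof. by rewrite ltr0n; apply/card_gt0P; exists x0. Qed.

Definition deviation (f : {ffun V -> 'I_n}) (h : edge_marks C n) : R :=
  \sum_y `|law_of (mu h) (pull f) y - k^-1 ^+ m|.

Lemma deviation_ge0 f h : 0 <= deviation f h.
Proof. exact: sumr_ge0. Qed.

Lemma sum_deviation_le (a : R) h : 0 < a -> 0 < pmf h ->
  \sum_f deviation f h <=
  k ^+ m * (m%:R * (n%:R ^+ m * (2 * a + (\sum_z overlap_moment (mu h) z) / a ^+ 3))).
Proof.
move=> a0 /well_defined Zh; rewrite exchange_big/=.
have q0 := @canonical_measure_ge0 R X C psi psi_ge0 (mgraph_of h).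
have q1 := canonical_measure_sum1 Zh.
have I0 : (0 < #|'I_n|)%N by rewrite card_ord.
apply: (@le_trans _ _ (\sum_(y : {ffun V -> X})
  m%:R * (n%:R ^+ m * (2 * a + (\sum_z overlap_moment (mu h) z) / a ^+ 3)))).
  apply: ler_sum => y _.
  have := sampled_law_near_uniform q0 q1 I0 y a0; rewrite card_ord.
  exact: le_trans.
by rewrite sumr_const card_ffun -[X in X <= _]mulr_natl natrX.
Qed.

Lemma expected_deviation_le (a : R) : 0 < a ->
  (\sum_(f : {ffun V -> 'I_n}) \esum_(h in setT) (pmf h * deviation f h)%:E <=
   (k ^+ m * m%:R * n%:R ^+ m)%:E * ((2 * a)%:E + (a ^- 3)%:E * total_defect))%E.
Proof.
move=> a0; rewrite -esum_sum; last first.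
  by move=> h f _ _; rewrite lee_fin mulr_ge0// deviation_ge0.
set c := k ^+ m * m%:R * n%:R ^+ m.
have c0 : 0 <= c by rewrite !mulr_ge0 ?exprn_ge0 ?(ltW k_gt0).
have om0 h : 0 <= \sum_z overlap_moment (mu h) z.
  by rewrite sumr_ge0// => z _; apply: overlap_moment_ge0 => x; exact: canonical_measure_ge0.
apply: (@le_trans _ _ (\esum_(h in [set: edge_marks C n])
   (c%:E * ((2 * a)%:E * (pmf h)%:E +
            (a ^- 3)%:E * (pmf h * \sum_z overlap_moment (mu h) z)%:E)))%E).
  apply: le_esum => h _; rewrite sumEFin -mulr_sumr -!EFinM lee_fin.
  have [/eqP->|ph] := boolP (pmf h == 0); first by rewrite !mul0r !mulr0 addr0 mulr0.
  have {}ph : 0 < pmf h by rewrite lt_neqAle eq_sym ph pmf_ge0.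
  apply: (@le_trans _ _ (pmf h * (k ^+ m * (m%:R * (n%:R ^+ m *
    (2 * a + (\sum_z overlap_moment (mu h) z) / a ^+ 3)))))).
    by rewrite ler_wpM2l// sum_deviation_le.
  have alg (P K M N b O A : R) :
      P * (K * (M * (N * (b + O / A)))) = K * M * N * (b * P + A^-1 * (P * O)).
    by ring.
  by rewrite alg.
rewrite esumZl//; last first.
  by move=> h; rewrite -!EFinM lee_fin addr_ge0 ?mulr_ge0 ?invr_ge0 ?exprn_ge0 ?(ltW a0).
rewrite lee_wpmul2l ?lee_fin//.
rewrite esumD; last 2 first.
- by move=> h _; rewrite -EFinM lee_fin !mulr_ge0 ?(ltW a0).
- by move=> h _; rewrite -EFinM lee_fin !mulr_ge0 ?invr_ge0 ?exprn_ge0 ?(ltW a0).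
rewrite !esumZl ?mulr_ge0 ?invr_ge0 ?exprn_ge0 ?(ltW a0)//; last first.
  by move=> h; rewrite lee_fin mulr_ge0.
rewrite graph_pmf_sum1// mule1 leeD2l//.
by rewrite lee_wpmul2l ?expected_overlap_moment_le// lee_fin invr_ge0 exprn_ge0 ?(ltW a0).
Qed.

Variables (t : nat) (delta : R) (B : rgraph C -> Prop).
Hypotheses (tl : (t <= l)%N) (delta_gt0 : 0 < delta).
Hypothesis close_B : forall G : rgraph C,
  `|recon_tv psi G t - recon_tv psi T t| <= delta -> B G.

Let e : R := Num.min (delta / 6) (1 / 2).
Let e_gt0 : 0 < e.
Proof. by rewrite lt_min !divr_gt0. Qed.

Let not_B (w : edge_marks C n * 'I_n) : R :=
  (`[< ~ B (@RGraph C (mgraph_of w.1) w.2) >])%:R.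

(** If the law sampled in [h] were within relative distance [e] of uniform, then
[recon_tv_close] would put the multigraph in [B]. *)
Lemma far_event_deviation g (f : {ffun V -> 'I_n}) : emb g f -> 0 < pmf g ->
  not_B (g, f (groot T)) <= (k ^+ m / e) * deviation f (strip l (@gwdepth C l tr) f g).
Proof.
move=> gf pg; set h := strip _ _ _ _; rewrite /not_B /=.
have dev0 : 0 <= k ^+ m / e * deviation f h.
  by rewrite mulr_ge0 ?deviation_ge0// divr_ge0 ?exprn_ge0 ?(ltW k_gt0) ?(ltW e_gt0).
case: asboolP => //= nB.
have fI : injective f by case: gf.
have ph : 0 < pmf h.
  have := graph_pmf_plant dP gamma p fI (strip_avoids l (@gwdepth C l tr) f g).
  rewrite (plant_strip dP gf) => E; rewrite lt_neqAle pmf_ge0 andbT eq_sym.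
  by apply: contraTneq pg => h0; rewrite E h0 mulr0 ltxx.
have [ue|] := pselect (forall y, `|k ^+ m * law_of (mu h) (pull f) y - 1| <= e).
  case: nB; apply: close_B.
  apply: le_trans (recon_tv_close psi_ge0 psi_sym dP tl gf x0 _
    (well_defined pg) (well_defined ph) ue) _.
    by rewrite (ltW e_gt0)/= ge_min lexx orbT.
  rewrite -ler_pdivlMl// mulrC ge_min lexx//.
move=> /existsNP[y /negP]; rewrite -ltNge => ey.
have km0 : 0 < k ^+ m by rewrite exprn_gt0.
rewrite mulrAC ler_pdivlMr// mul1r; apply: le_trans (ltW ey) _.
rewrite /deviation (bigD1 y)//= mulrDr.
have -> : k ^+ m * law_of (mu h) (pull f) y - 1 =
    k ^+ m * (law_of (mu h) (pull f) y - k^-1 ^+ m).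
  by rewrite mulrBr exprVn divff// gt_eqF.
by rewrite normrM (gtr0_norm km0) lerDl mulr_ge0 ?(ltW km0)// sumr_ge0.
Qed.

Definition bad_factor : R :=
  edge_product / (orderings tr)%:R * (k ^+ m / e) * k ^+ m * m%:R.

Lemma bad_factor_ge0 : 0 <= bad_factor.
Proof.
by rewrite !mulr_ge0 ?invr_ge0 ?exprn_ge0 ?(ltW k_gt0) ?(ltW e_gt0).
Qed.

(** Markov's inequality for the deviation, after which the planted multigraph is
replaced by the unconditioned one.  The powers of n cancel: n ^ (1 - m) from the
edges, 1 / n from the root and n ^ m from the labellings. *)
Lemma bad_mass_le (a : R) : 0 < a ->
  (\esum_(w in [set: edge_marks C n * 'I_n])
     (pmf w.1 / n%:R * (root_share w * not_B w))%:E <=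
   bad_factor%:E * ((2 * a)%:E + (a ^- 3)%:E * total_defect))%E.
Proof.
move=> a0; rewrite esum_root_share//.
pose c := n%:R^-1 * (orderings tr)%:R^-1 : R.
pose kF := edges_factor n T gamma p.
have c0 : 0 <= c by rewrite mulr_ge0.
have kF0 : 0 <= kF by apply: edges_factor_ge0.
have ke0 : 0 <= k ^+ m / e by rewrite divr_ge0 ?exprn_ge0 ?(ltW k_gt0) ?(ltW e_gt0).
apply: (@le_trans _ _ (\sum_(f : {ffun V -> 'I_n}) (c * kF * (k ^+ m / e))%:E *
    \esum_(h in setT) (pmf h * deviation f h)%:E)%E).
  apply: lee_sum => f _.
  have [fI|nfI] := pselect (injective f); last first.
    rewrite esum1 ?mule0; last by move=> g [].
    apply: mule_ge0; first by rewrite lee_fin mulr_ge0// mulr_ge0.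
    by apply: esum_ge0 => h _; rewrite lee_fin mulr_ge0 ?deviation_ge0.
  rewrite -(mulrA c) (EFinM c) -muleA lee_wpmul2l ?lee_fin//.
  have := embeds_sum_le dP gamma_ge0 p_ge0 (u := fun h => k ^+ m / e * deviation f h) fI.
  move=> /(_ (fun h => mulr_ge0 ke0 (deviation_ge0 f h))) H.
  apply: (le_trans _ (le_trans H _)).
    apply: le_esum => g gf; rewrite lee_fin.
    have [/eqP->|pg] := boolP (pmf g == 0); first by rewrite !mul0r.
    by rewrite ler_wpM2l// far_event_deviation// lt_neqAle eq_sym pg pmf_ge0.
  rewrite -/kF (EFinM kF) -muleA lee_wpmul2l ?lee_fin//.
  rewrite -esumZl//; last by move=> h; rewrite lee_fin mulr_ge0 ?deviation_ge0.
  by apply: le_esum => h _; rewrite -EFinM lee_fin mulrCA.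
rewrite -ge0_sume_distrr; last first.
  move=> f _; apply: esum_ge0 => h _.
  by rewrite lee_fin mulr_ge0 ?deviation_ge0.
apply: (@le_trans _ _ ((c * kF * (k ^+ m / e))%:E *
  ((k ^+ m * m%:R * n%:R ^+ m)%:E * ((2 * a)%:E + (a ^- 3)%:E * total_defect)))%E).
  by rewrite lee_wpmul2l ?expected_deviation_le// lee_fin mulr_ge0// mulr_ge0.
rewrite muleA -EFinM (_ : c * kF * _ * _ = bad_factor)//.
have alg (E O q P K M : R) : q != 0 -> O != 0 -> P != 0 ->
    q^-1 * O^-1 * (q * E / P) * (K / e) * (K * M * P) = E / O * (K / e) * K * M.
  by move=> *; field; rewrite (gt_eqF e_gt0); apply/and4P.
rewrite /bad_factor /c /kF edges_factorE.
by apply: alg; rewrite ?expf_neq0// pnatr_eq0 -lt0n orderings_gt0.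
Qed.

End OneTree.

End FixedSize.

(** * Passage to the limit *)

Lemma ffact_ratio_ge (R : realType) (n m : nat) : (0 < n)%N ->
  1 - m%:R ^+ 2 / n%:R <= (n ^_ m)%:R / n%:R ^+ m :> R.
Proof.
move=> n_gt0; have n0 : 0 < n%:R :> R by rewrite ltr0n.
elim: m => [|m IH]; first by rewrite expr0n mul0r subr0 ffactn0 expr0 divr1.
set r := (n ^_ m)%:R / n%:R ^+ m in IH.
have -> : (n ^_ m.+1)%:R / n%:R ^+ m.+1 = r * ((n - m)%:R / n%:R) :> R.
  by rewrite ffactnSr natrM exprSr invfM mulrACA.
have r1 : r <= 1.
  rewrite ler_pdivrMr ?exprn_gt0// mul1r -natrX ler_nat.
  elim: m {IH r} => // m IHm; rewrite ffactnSr expnSr leq_mul//.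
  exact: leq_subr.
have r0 : 0 <= r by rewrite divr_ge0 ?exprn_ge0 ?(ltW n0).
have s1 : 1 - m%:R / n%:R <= (n - m)%:R / n%:R :> R.
  have nn : n%:R != 0 :> R by rewrite gt_eqF.
  rewrite -{1}(divff nn) -mulrBl ler_pM2r ?invr_gt0//.
  by rewrite lerBlDr -natrD ler_nat addnC -leq_subLR.
apply: (@le_trans _ _ (r * (1 - m%:R / n%:R))); last by rewrite ler_wpM2l.
set a := m%:R / n%:R in s1 *; have a0 : 0 <= a by rewrite divr_ge0// ltW.
have -> : m.+1%:R ^+ 2 / n%:R = m%:R ^+ 2 / n%:R + 2 * a + n%:R^-1 :> R.
  by rewrite /a -natr1; field; rewrite gt_eqF.
have : 0 <= n%:R^-1 :> R by rewrite invr_ge0 ltW.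
have : r * a <= a by rewrite ler_piMl.
by move: IH; lra.
Qed.

Section TotalMass.
Variables (R : realType) (C : finType) (M : random_rgraph R C).
Hypotheses (mass_ge0 : forall w : outcome M, 0 <= mass w)
  (mass_sum1 : (\esum_(w in [set: outcome M]) (mass w)%:E = 1)%E).

Lemma PrE A : Pr M A =
  (\esum_(w in [set: outcome M]) (mass w * (`[< A (graph_at w) >])%:R)%:E)%E.
Proof. by rewrite /Pr (esum_setE (fun w => A (graph_at w))). Qed.

Lemma Pr_compl A : (Pr M A + Pr M (fun G => ~ A G) = 1)%E.
Proof.
rewrite !PrE -esumD => [|w _|w _]; do ?by rewrite lee_fin mulr_ge0.
rewrite -mass_sum1; apply: eq_esum => w _; rewrite -EFinD -mulrDr.
by case: (asboolP (A _)) => HA; [rewrite asboolF|rewrite asboolT];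
  rewrite ?addr0 ?add0r ?mulr1//; exact.
Qed.

Lemma Pr_ge0 A : (0 <= Pr M A)%E.
Proof. by apply: esum_ge0 => w _; rewrite lee_fin. Qed.

Lemma Pr_fin A : Pr M A \is a fin_num.
Proof.
rewrite ge0_fin_numE ?Pr_ge0//.
apply: (@le_lt_trans _ _ 1%E); last by rewrite ltry.
by rewrite -(Pr_compl A) leeDl// Pr_ge0.
Qed.

Lemma Pr_finite_approx A (e : R) : 0 < e -> exists S : seq (outcome M),
  [/\ uniq S, (forall w, w \in S -> A (graph_at w)) &
      (Pr M A <= (\sum_(w <- S) mass w)%:E + e%:E)%E].
Proof.
move=> e0; have [S uS HS] : exists2 S : seq (outcome M), uniq S &
    (Pr M A <= (\sum_(w <- S) mass w * (`[< A (graph_at w) >])%:R)%:E + e%:E)%E.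
  apply: contrapT => H.
  suff : (Pr M A <= Pr M A - e%:E)%E.
    rewrite leeBrDr// -[leRHS]adde0 leeD2lE ?Pr_fin// lee_fin leNgt e0//.
  rewrite {1}PrE; apply: esum_le_sum => S uS; rewrite sumEFin leeBrDr//.
  by rewrite leNgt; apply/negP => /ltW le; apply: H; exists S.
exists [seq w <- S | `[< A (graph_at w) >]]; split.
- by rewrite filter_uniq.
- by move=> w; rewrite mem_filter => /andP[/asboolP].
- apply: le_trans HS _; rewrite leeD2r// lee_fin [leRHS]big_filter [leRHS]big_mkcond/=.
  by apply: ler_sum => w _; case: (`[< A _ >]); rewrite ?mulr1 ?mulr0.
Qed.

End TotalMass.

Section Limsup.
Variable R : realType.
Implicit Types (u : nat -> \bar R) (c : \bar R).

Lemma limn_esup_le_near u c : (\forall n \near \oo, u n <= c)%E ->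
  (limn_esup u <= c)%E.
Proof.
move=> H; apply: (@le_trans _ _ (ereal_sup (u @` [set n | (u n <= c)%E]))).
  by apply: ereal_inf_lbound; exists [set n | (u n <= c)%E].
by apply: ge_ereal_sup => _ [n un <-].
Qed.

Lemma limn_esup_ge_near u c : (\forall n \near \oo, c <= u n)%E ->
  (c <= limn_esup u)%E.
Proof.
move=> H; apply: le_ereal_inf_tmp => _ [V FV <-].
have [n [/= cn Vn]] := @filter_ex _ \oo _ _ (filterI H FV).
by apply: le_trans cn _; apply: ereal_sup_ubound; exists n.
Qed.

End Limsup.

Section Transfer.
Variables (R : realType) (X C : finType) (gamma : R) (psi : C -> X -> X -> R)
  (p : C -> R).
Hypotheses (gamma_ge0 : 0 <= gamma) (psi_ge0 : forall a x y, 0 <= psi a x y)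
  (psi_sym : forall a x y, psi a x y = psi a y x)
  (p_ge0 : forall a, 0 <= p a) (p_sum1 : \sum_a p a = 1).
Hypothesis well_defined : forall n (g : edge_marks C n),
  0 < poisson_graph_pmf gamma p g -> 0 < partition_fun psi (mgraph_of g).
Hypothesis defect_cvg : total_defect gamma psi p n @[n --> \oo] --> 0%E.

Lemma graph_model_mass_ge0 n (w : outcome (poisson_model gamma p n)) : 0 <= mass w.
Proof. by rewrite divr_ge0// graph_pmf_ge0. Qed.

Lemma graph_model_sum1 n : (0 < n)%N ->
  (\esum_(w in [set: outcome (poisson_model gamma p n)]) (mass w)%:E = 1)%E.
Proof.
move=> n_gt0; rewrite (@esum_pair _ (edge_marks C n) 'I_n); last first.
  by move=> w; rewrite lee_fin divr_ge0// graph_pmf_ge0.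
rewrite -(graph_pmf_sum1 gamma_ge0 p_ge0 p_sum1 n); apply: eq_esum => g _.
rewrite (@esum_finType _ 'I_n); last first.
  by move=> w; rewrite lee_fin divr_ge0// graph_pmf_ge0.
rewrite sumEFin /= sumr_const card_ord -[_ *+ n]mulr_natr mulfVK//.
by rewrite pnatr_eq0 -lt0n.
Qed.

Variable x0 : X.
Variables (l t : nat) (delta : R) (B : rgraph C -> Prop).
Hypotheses (tl : (t <= l)%N) (delta_gt0 : 0 < delta).

(** The shares of the trees in [S] add up to at most 1 on a multigraph in [B]; on
the other ones their mass is bounded by [bad_mass_le]. *)
Lemma trees_le_graph (S : seq (gwtree C l)) (a : R) n : (0 < n)%N -> uniq S ->
  (forall tr G, tr \in S ->
     `|recon_tv psi G t - recon_tv psi (gwgraph tr) t| <= delta -> B G) ->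
  0 < a ->
  ((\sum_(tr <- S) gw_pmf gamma p tr * (n ^_ #|vert (gwgraph tr)|)%:R
        / n%:R ^+ #|vert (gwgraph tr)|)%:E <=
   Pr (poisson_model gamma p n) B +
   (\sum_(tr <- S) bad_factor X gamma p tr delta)%:E *
     ((2 * a)%:E + (a ^- 3)%:E * total_defect gamma psi p n))%E.
Proof.
move=> n_gt0 uS close a0.
rewrite (@PrE _ _ (poisson_model gamma p n)).
pose nB (w : edge_marks C n * 'I_n) : R :=
  (`[< ~ B (@RGraph C (mgraph_of w.1) w.2) >])%:R.
pose mass (w : edge_marks C n * 'I_n) : R := poisson_graph_pmf gamma p w.1 / n%:R.
have m0 (w : edge_marks C n * 'I_n) : 0 <= mass w by rewrite divr_ge0// graph_pmf_ge0.
have s0 tr w : 0 <= root_share R (n := n) (l := l) tr w by exact: root_share_ge0.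
apply: (@le_trans _ _ (\sum_(tr <- S)
   \esum_(w in [set: edge_marks C n * 'I_n]) (mass w * root_share R tr w)%:E)%E).
  by rewrite -sumEFin; apply: lee_sum => tr _; exact: root_share_mass_ge.
rewrite -esum_sum; last by move=> w tr _ _; rewrite lee_fin mulr_ge0.
apply: (@le_trans _ _ (\esum_(w in [set: edge_marks C n * 'I_n])
   ((mass w * (`[< B (@RGraph C (mgraph_of w.1) w.2) >])%:R)%:E +
    \sum_(tr <- S) (mass w * (root_share R tr w * nB w))%:E))%E).
  apply: le_esum => w _; rewrite !sumEFin -!mulr_sumr -EFinD -mulrDr lee_fin.
  rewrite ler_wpM2l// -mulr_suml /nB.
  case: (asboolP (B _)) => HB.
    rewrite asboolF; last by move=> nHB; exact: nHB.
    by rewrite mulr0 addr0 /root_share; exact: sum_share_embeddings.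
  by rewrite asboolT//= mulr1 add0r.
rewrite esumD; last 2 first.
- by move=> w _; rewrite lee_fin mulr_ge0.
- move=> w _; rewrite sume_ge0// => tr _; rewrite lee_fin mulr_ge0// mulr_ge0//.
rewrite leeD2l// esum_sum; last first.
  by move=> w tr _ _; rewrite lee_fin mulr_ge0// mulr_ge0.
have D0 : (0 <= (2 * a)%:E + (a ^- 3)%:E * total_defect gamma psi p n)%E.
  rewrite adde_ge0 ?lee_fin ?mulr_ge0 ?(ltW a0)// mule_ge0//.
    by rewrite lee_fin invr_ge0 exprn_ge0 ?(ltW a0).
  apply: sume_ge0 => z _; apply: esum_ge0 => w _; rewrite lee_fin.
  rewrite mulr_ge0 ?sqr_ge0// mulr_ge0 ?graph_pmf_ge0//.
  by rewrite mulr_ge0 ?canonical_measure_ge0.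
rewrite -sumEFin ge0_sume_distrl; last first.
  by move=> tr _; rewrite lee_fin bad_factor_ge0.
rewrite big_seq [leRHS]big_seq; apply: lee_sum => tr trS.
exact: (bad_mass_le gamma_ge0 psi_ge0 psi_sym p_ge0 p_sum1 n_gt0
  (@well_defined n) x0 tl delta_gt0 (fun G => @close tr G trS) a0).
Qed.

Lemma trees_le_graph_near (S : seq (gwtree C l)) (eta : R) : uniq S ->
  (forall tr G, tr \in S ->
     `|recon_tv psi G t - recon_tv psi (gwgraph tr) t| <= delta -> B G) ->
  0 < eta ->
  \forall n \near \oo, ((\sum_(tr <- S) gw_pmf gamma p tr)%:E <=
     Pr (poisson_model gamma p n) B + eta%:E)%E.
Proof.
move=> uS close eta0.
pose M := \sum_(tr <- S) bad_factor X gamma p tr delta.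
have M0 : 0 <= M by rewrite sumr_ge0// => tr _; exact: bad_factor_ge0.
(* With total defect at most a ^ 4 the error is M (2 a + a); M may vanish. *)
pose a := eta / (6 * (M + 1)).
have M1 : 0 < 6 * (M + 1) by rewrite mulr_gt0// ltr_wpDl.
have a0 : 0 < a by rewrite divr_gt0.
have Ma : M * (2 * a + a) <= eta / 2.
  have : a * (6 * (M + 1)) = eta by rewrite mulfVK// gt_eqF.
  have alg (x y z : R) : 0 <= x -> x * (6 * (y + 1)) = z ->
      y * (2 * x + x) <= z / 2 by move=> ? <-; lra.
  exact: alg (ltW a0).
pose Q := \sum_(tr <- S) gw_pmf gamma p tr * #|vert (gwgraph tr)|%:R ^+ 2.
have small : \forall n \near \oo, (total_defect gamma psi p n <= (a ^+ 4)%:E)%E.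
  move/fine_cvgP : defect_cvg => [fin lim].
  have lt := cvgr_lt _ lim _ (exprn_gt0 4 a0).
  near=> n; rewrite -[leLHS]fineK; last by near: n.
  by rewrite lee_fin ltW//; near: n; exact: lt.
near=> n.
have n_gt0 : (0 < n)%N by near: n; exact: nbhs_infty_gt.
have n0 : 0 < n%:R :> R by rewrite ltr0n.
have Dn : (total_defect gamma psi p n <= (a ^+ 4)%:E)%E by near: n; exact: small.
have Qn : Q / n%:R <= eta / 2.
  rewrite ler_pdivrMr// mulrC -ler_pdivrMr ?divr_gt0//.
  by near: n; exact: nbhs_infty_ger.
have H := trees_le_graph n_gt0 uS close a0.
apply: (@le_trans _ _ ((\sum_(tr <- S) gw_pmf gamma p tr * (n ^_ #|vert (gwgraph tr)|)%:R
        / n%:R ^+ #|vert (gwgraph tr)|)%:E + (eta / 2)%:E)%E).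
  rewrite -EFinD lee_fin -lerBlDr.
  apply: (@le_trans _ _ (\sum_(tr <- S) gw_pmf gamma p tr - Q / n%:R)).
    by rewrite lerD2l lerN2.
  rewrite /Q mulr_suml -sumrB; apply: ler_sum => tr _.
  rewrite -!mulrA -{1}[gw_pmf _ _ _]mulr1 -mulrBr ler_wpM2l ?gw_pmf_ge0//.
  by rewrite mulrA -expr2; exact: ffact_ratio_ge.
rewrite [eta in leRHS]splitr EFinD addeA leeD2r//.
apply: le_trans H _; rewrite leeD2l// -/M.
apply: (@le_trans _ _ (M%:E * ((2 * a)%:E + (a ^- 3)%:E * (a ^+ 4)%:E))%E).
  rewrite lee_wpmul2l ?lee_fin// leeD2l// lee_wpmul2l// lee_fin invr_ge0.
  by rewrite exprn_ge0// ltW.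
by rewrite -!EFinM lee_fin (exprSr a 3) mulKf ?expf_neq0 ?gt_eqF.
Unshelve. all: by end_near.
Qed.

Lemma tree_event_le_graph_event (A : rgraph C -> Prop) (eta : R) :
  (forall G G' : rgraph C, A G ->
     `|recon_tv psi G' t - recon_tv psi G t| <= delta -> B G') ->
  0 < eta ->
  \forall n \near \oo, (Pr (gw_model gamma p l) A <=
     Pr (poisson_model gamma p n) B + eta%:E)%E.
Proof.
move=> AB eta0.
have mass0 (w : outcome (gw_model gamma p l)) : 0 <= mass w by exact: gw_pmf_ge0.
have e2 : 0 < eta / 2 by rewrite divr_gt0.
have [S [uS SA HS]] := Pr_finite_approx mass0 (gw_pmf_sum1 gamma_ge0 p_ge0 p_sum1 l) A e2.
have close tr G : tr \in S ->
     `|recon_tv psi G t - recon_tv psi (gwgraph tr) t| <= delta -> B G.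
  by move=> /SA/AB; exact.
have := trees_le_graph_near uS close e2; apply: filterS => n Hn.
rewrite [eta in leRHS]splitr EFinD addeA; apply: le_trans HS _.
by rewrite leeD2r.
Qed.

End Transfer.

(** The empty multigraph on one vertex has positive probability. *)
Lemma well_defined_inhabited (R : realType) (X C : finType) (gamma : R)
    (psi : C -> X -> X -> R) (p : C -> R) :
  (forall g : edge_marks C 1,
     0 < poisson_graph_pmf gamma p g -> 0 < partition_fun psi (mgraph_of g)) ->
  inhabited X.
Proof.
move=> wd; have [//|noX] := pselect (inhabited X).
suff pg : 0 < poisson_graph_pmf gamma p ([ffun=> [::]] : edge_marks C 1).
  have := wd _ pg; rewrite /partition_fun big1 ?ltxx// => x _.
  by case: noX; exact: inhabits (x ord0).
rewrite prodr_gt0// => ij _; rewrite ffunE big_nil mulr1 /poisson_mass /=.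
by rewrite expr0 mulr1 fact0 divr1 expR_gt0.
Qed.

Theorem theorem5p4 (R : realType) (X C : finType) (gamma : R)
    (psi : C -> X -> X -> R) (p : C -> R)
    (gamma_ge0 : 0 <= gamma)
    (psi_ge0 : forall a x y, 0 <= psi a x y)
    (psi_sym : forall a x y, psi a x y = psi a y x)
    (p_ge0 : forall a, 0 <= p a)
    (p_sum1 : \sum_a p a = 1)
    (well_defined : forall n (g : edge_marks C n),
       0 < poisson_graph_pmf gamma p g -> 0 < partition_fun psi (mgraph_of g))
    (small_overlap : forall x : X,
       (fun n => replica_expectation gamma p psi
          (fun x1 x2 : {ffun 'I_n -> X} =>
             (delta_type R x1 x2 x x
              - 2 * #|X|%:R^-1 * \sum_x' delta_type R x1 x2 x x') ^+ 2))
       @ \oo --> 0%E) :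
  recon_solvable psi (poisson_model gamma p) <-> tree_solvable gamma p psi.
Proof.
have [x0] := well_defined_inhabited (@well_defined 1%N).
have defect_cvg : total_defect gamma psi p n @[n --> \oo] --> 0%E.
  rewrite (_ : 0%E = \sum_(z : X) 0%E); last by rewrite big1_eq.
  apply: cvg_nnesum => z _; last exact: small_overlap.
  near=> n; apply: esum_ge0 => w _; rewrite lee_fin mulr_ge0 ?sqr_ge0//.
  by rewrite mulr_ge0 ?graph_pmf_ge0// mulr_ge0 ?canonical_measure_ge0.
have transfer := tree_event_le_graph_event gamma_ge0 psi_ge0 psi_sym p_ge0 p_sum1
  well_defined defect_cvg x0.
have tree_mass0 l (w : outcome (gw_model gamma p l)) : 0 <= mass w by exact: gw_pmf_ge0.
have tree_sum1 l := gw_pmf_sum1 gamma_ge0 p_ge0 p_sum1 l.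
have graph_mass0 n (w : outcome (poisson_model gamma p n)) : 0 <= mass w.
  exact: graph_model_mass_ge0.
have graph_sum1 := graph_model_sum1 gamma_ge0 p_ge0 p_sum1.
split=> -[eps eps0 sol]; exists (eps / 2); rewrite ?divr_gt0//.
(* An upper bound for the graph is a lower bound for the complement. *)
- apply: (lt_le_trans sol); apply: le_ereal_inf_tmp => _ [t _ <-].
  apply: (@le_trans _ _ (limn_esup (fun n =>
    Pr (poisson_model gamma p n) (solvable_at psi t eps)))).
    by apply: ereal_inf_lbound; exists t.
  apply: limn_esup_ge_near; near=> l.
  have tl : (t <= l)%N by near: l; exact: nbhs_infty_ge.
  apply/lee_addgt0Pr => eta eta0; apply: limn_esup_le_near.
  near=> n.
  have n_gt0 : (0 < n)%N by near: n; exact: nbhs_infty_gt.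
  have H : (Pr (gw_model gamma p l) (fun G => ~ solvable_at psi t (eps / 2) G) <=
     Pr (poisson_model gamma p n) (fun G => ~ solvable_at psi t eps G) + eta%:E)%E.
    near: n; apply: (transfer l t (eps / 2)) => //; first by rewrite divr_gt0.
    move=> G G'; rewrite /solvable_at => /negP; rewrite -ltNge => GA.
    rewrite ler_norml => /andP[_ ?]; apply/negP; rewrite -ltNge.
    by rewrite [ltRHS]splitr; lra.
  have cT := Pr_compl (tree_mass0 l) (tree_sum1 l) (solvable_at psi t (eps / 2)).
  have cG := Pr_compl (graph_mass0 n) (graph_sum1 n n_gt0) (solvable_at psi t eps).
  have fT := Pr_fin (tree_mass0 l) (tree_sum1 l).
  have fG := Pr_fin (graph_mass0 n) (graph_sum1 n n_gt0).
  move: cT cG H; rewrite -(fineK (fT (solvable_at psi t (eps / 2)))).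
  rewrite -(fineK (fT (fun G => ~ solvable_at psi t (eps / 2) G))).
  rewrite -(fineK (fG (solvable_at psi t eps))).
  rewrite -(fineK (fG (fun G => ~ solvable_at psi t eps G))).
  rewrite -!EFinD !lee_fin => -[cT] [cG] H.
  by lra.
(* From the tree to the graph the lower bound is enough. *)
- apply: (lt_le_trans sol); apply: le_ereal_inf_tmp => _ [t _ <-].
  apply: (@le_trans _ _ (limn_esup (fun l =>
    Pr (gw_model gamma p l) (solvable_at psi t eps)))).
    by apply: ereal_inf_lbound; exists t.
  apply: limn_esup_le_near; near=> l.
  have tl : (t <= l)%N by near: l; exact: nbhs_infty_ge.
  apply/lee_addgt0Pr => eta eta0; rewrite -leeBlDr//.
  apply: limn_esup_ge_near; near=> n; rewrite leeBlDr//.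
  near: n; apply: (transfer l t (eps / 2)) => //; first by rewrite divr_gt0.
  move=> G G'; rewrite /solvable_at => GA.
  by rewrite ler_norml => /andP[? _]; move: GA; rewrite [leLHS]splitr; lra.
Unshelve. all: by end_near.
Qed.
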